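(* Let $p$ be a polynomial over $\mathbb{C}$ of degree $d\geq 2$ and let $P$ be the corresponding matrix-valued polynomial on $\mathcal{M}(2,\mathbb{C})$. Let $R>1$ be sufficiently large that the Böttcher function $\varphi_p$ of $p$ is well defined in $\Omega_R=\{z\in\mathbb{C}:\lvert z\rvert>R\}$, and let $$\Omega=\{M\in\mathcal{M}(2,\mathbb{C}):\text{the eigenvalues of }M\text{ lie in }\Omega_R\}.$$ Then there exists a holomorphic function $\Phi_P:\Omega\to\Omega$ such that $$\Phi_P\circ P(M)=(\Phi_P(M))^d\quad\text{and}\quad G(M)=\log\rho(\Phi_P(M))$$ for all $M\in\Omega$.
   Context: $\mathcal{M}(2,\mathbb{C})\cong\mathbb{C}^4$ is the space of $2\times 2$ complex matrices and $\rho(M)$ is the spectral radius of $M$. For a polynomial $p(z)=a_kz^k+\cdots+a_1z+a_0$ over $\mathbb{C}$, the corresponding matrix-valued polynomial is $P(M)=a_kM^k+\cdots+a_1M+a_0\mathrm{Id}$; $P^n$ denotes the $n$-fold iterate. The Böttcher function of $p$ is the holomorphic function $\varphi_p$ near infinity, with expansion $\varphi_p(z)=bz+b_0+\frac{b_1}{z}+\cdots$ ($b\ne0$), satisfying $\varphi_p(p(z))=(\varphi_p(z))^d$ and $G_p(z)=\log\lvert\varphi_p(z)\rvert$, where $G_p$ is the Green function of the filled Julia set of $p$ with logarithmic pole at infinity. $G$ is the dynamical Green function of $P$: $G(M)=\lim_{n\to\infty}\frac{1}{d^n}\log\lVert P^n(M)\rVert$, where $\lVert\cdot\rVert$ is a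 fixed matrix norm on $\mathcal{M}(2,\mathbb{C})$.
   Formalization: Φ_P:Ω→Ω is false in general (p=z²/2, φ_p=z/2); instead the eigenvalues of Φ_P(M) lie in φ_p(Ω_R), and Φ_P maps Ω to Ω whenever φ_p(Ω_R)⊂Ω_R. R is taken so large that p maps Ω_R into itself, so that Φ_P∘P is defined on Ω. *)

(* Defs.v *)
From HB Require Import structures.
From mathcomp Require Import all_boot all_order all_algebra.
From mathcomp Require Import all_classical all_reals all_analysis.
From mathcomp Require Import complex.
Set Implicit Arguments. Unset Strict Implicit. Unset Printing Implicit Defensive.
Import Order.TTheory GRing.Theory Num.Theory.
Import numFieldNormedType.Exports.
Local Open Scope classical_set_scope.
Local Open Scope ring_scope.
(* The library puts the norm topology on the regular module R[i]^o only; this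
   transports it to R[i] itself, hence to the matrices over R[i]. Norms on these
   spaces are R[i]-valued; [Normc.normc] is the real-valued modulus. *)
HB.instance Definition _ (R : realType) := NormedModule.copy R[i] R[i]^o.

(* For K = R[i] the differential is a C-linear map, so this is complex
   differentiability, in one or several complex variables. *)
Definition holomorphic_on (K : numFieldType) (V W : normedModType K)
    (U : set V) (f : V -> W) : Prop :=
  forall x, U x -> differentiable f x.

Definition exterior (R : realType) (r : R) : set R[i] :=
  [set z | r < Normc.normc z].

Definition spectrum_in (R : realType) (U : set R[i]) : set 'M[R[i]]_2 :=
  [set M | forall l : R[i], eigenvalue M l -> U l].

Definition spectral_radius (R : realType) (M : 'M[R[i]]_2) : R :=
  sup [set Normc.normc l | l in [set l : R[i] | eigenvalue M l]].

Definition mxpoly_map (R : realType) (p : {poly R[i]}) (M : 'M[R[i]]_2) :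
    'M[R[i]]_2 :=
  horner_mx M p.

Definition filled_julia (R : realType) (p : {poly R[i]}) : set R[i] :=
  [set z | exists B : R, forall n : nat, Normc.normc (iter n (horner p) z) <= B].

(* u is C^2 on the open set U (the second-order directional derivatives exist
   and are continuous) and its Laplacian vanishes there. *)
Definition harmonic_on (R : realType) (U : set (R * R)) (u : R * R -> R) : Prop :=
  forall x, U x ->
    (forall v w : R * R,
       [/\ derivable u x v, derivable ('D_v u) x w
         & {for x, continuous ('D_w ('D_v u))}]) /\
    'D_(1, 0) ('D_(1, 0) u) x + 'D_(0, 1) ('D_(0, 1) u) x = 0.

(* The Green function of the compact set K with logarithmic pole at infinity. *)
Definition is_green_function (R : realType) (K : set R[i]) (g : R[i] -> R) :
    Prop :=
  [/\ continuous g,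
      forall z, K z -> g z = 0,
      harmonic_on [set xy | ~ K (xy.1 +i* xy.2)%C]
                  (fun xy : R * R => g (xy.1 +i* xy.2)%C)
    & exists A B : R, forall z, A < Normc.normc z ->
        `|g z - ln (Normc.normc z)| <= B].

(* phi is a Boettcher function of p (of degree d), well defined on |z| > r. The
   functional equation on |z| > r only makes sense if p maps this set to
   itself, which holds for all large r. On the other hand phi need not map
   |z| > r to itself, however large r is: for p = z^2 + 1, phi(z) = z + 1/(2z) + ...
   shrinks the modulus of z = iy, and for p = z^2 / 2, phi(z) = z / 2. *)
Definition is_bottcher (R : realType) (d : nat) (p : {poly R[i]}) (r : R)
    (phi : R[i] -> R[i]) : Prop :=
  [/\ holomorphic_on (exterior r) phi,
      exists (b : R[i]) (b_ : nat -> R[i]), b != 0 /\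
        forall z, exterior r z ->
          series (fun k => b_ k / z ^+ k) @ \oo --> phi z - b * z,
      forall z, exterior r z -> exterior r p.[z],
      forall z, exterior r z -> phi p.[z] = phi z ^+ d
    & exists2 g : R[i] -> R, is_green_function (filled_julia p) g
        & forall z, exterior r z ->
            phi z != 0 /\ g z = ln (Normc.normc (phi z))].

Definition is_matrix_norm (R : realType) (N : 'M[R[i]]_2 -> R) : Prop :=
  [/\ forall A, N A = 0 -> A = 0,
      forall A B, N (A + B) <= N A + N B
    & forall (c : R[i]) A, N (c *: A) = Normc.normc c * N A].

Definition green_seq (R : realType) (N : 'M[R[i]]_2 -> R) (d : nat)
    (p : {poly R[i]}) (M : 'M[R[i]]_2) (n : nat) : R :=
  (d%:R ^+ n)^-1 * ln (N (iter n (mxpoly_map p) M)).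

(* Meaningful when [green_seq N d p M] converges. *)
Definition dynamical_green (R : realType) (N : 'M[R[i]]_2 -> R) (d : nat)
    (p : {poly R[i]}) (M : 'M[R[i]]_2) : R :=
  limn (green_seq N d p M).

(* Main.v *)
(** Phi is the functional calculus of the Laurent expansion of phi,
    Phi(M) = b M + sum_k b_k M^-k.

    Convergence of the expansion on |z| > r gives |b_k| <= B s^k for every s > r.
    Conjugating M^-1 to a triangular matrix with small off-diagonal entry yields
    a submultiplicative norm nu with nu(M^-1) < 1/s; in this norm the series can
    be differentiated termwise, with a quadratic remainder, so Phi is
    holomorphic.

    On diagonalisable matrices the functional equation of Phi is that of phi on
    the eigenvalues; a matrix with a double eigenvalue is a limit of such.

    For the Green function, continuity of g and its logarithmic pole show that
    ln|z| - ln|phi(z)| is bounded on |z| > r. Hence the largest eigenvalue of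
    P^n(M) has modulus rho^(d^n) up to a bounded factor, where
    rho = max(|phi(l)|, |phi(m)|) = rho(Phi(M)) for the eigenvalues l, m of M.
    In triangular form the off-diagonal entry of P^n(M) is a product of
    difference quotients of p along the two orbits, so it is at most
    D^n rho^(d^n) up to a constant, and the factor D^n is killed by d^-n. *)
Require Import Defs.
From HB Require Import structures.
From mathcomp Require Import all_boot all_order all_algebra.
From mathcomp Require Import all_classical all_reals all_analysis.
From mathcomp Require Import complex ring lra.
Set Implicit Arguments. Unset Strict Implicit. Unset Printing Implicit Defensive.
Import Order.TTheory GRing.Theory Num.Theory.
Import numFieldNormedType.Exports.
Local Open Scope classical_set_scope.
Local Open Scope ring_scope.
Import Normc.

(** * The real-valued modulus on the complex numbers *)

Section Modulus.
Variable R : rcfType.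
Implicit Types x y : R[i].

Lemma normr_normc x : `|x| = (normc x)%:C%C. Proof. by []. Qed.

Lemma normc_ge0 x : 0 <= normc x.
Proof. by case: x => a b; exact: sqrtr_ge0. Qed.

Lemma normc_zero : normc (0 : R[i]) = 0. Proof. exact: normc0. Qed.

Lemma normcD x y : normc (x + y) <= normc x + normc y.
Proof. by have := ler_normD x y; rewrite !normr_normc -rmorphD lecR. Qed.

Lemma normcN x : normc (- x) = normc x.
Proof. by apply: complexI; rewrite -!normr_normc normrN. Qed.

Lemma normcB x y : normc (x - y) <= normc x + normc y.
Proof. by rewrite (le_trans (normcD _ _)) // normcN. Qed.

Lemma normc_distC x y : normc (x - y) = normc (y - x).
Proof. by rewrite -normcN opprB. Qed.

Lemma normcX x n : normc (x ^+ n) = normc x ^+ n.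
Proof. by elim: n => [|n IH]; rewrite ?normc1 // !exprS normcM IH. Qed.

Lemma normc_eq0 x : (normc x == 0) = (x == 0).
Proof.
apply/eqP/eqP => [|->]; [exact: eq0_normc|exact: normc0].
Qed.

Lemma normc_gt0 x : (0 < normc x) = (x != 0).
Proof. by rewrite lt_def normc_eq0 normc_ge0 andbT. Qed.

Lemma normc_sum (I : Type) (s : seq I) (F : I -> R[i]) :
  normc (\sum_(i <- s) F i) <= \sum_(i <- s) normc (F i).
Proof.
elim/big_ind2 : _ => [|a b c d ab cd|//]; first by rewrite normc0.
by rewrite (le_trans (normcD _ _)) // lerD.
Qed.

Lemma ReB x y : complex.Re (x - y) = complex.Re x - complex.Re y.
Proof. by case: x => a b; case: y => c d; rewrite /=. Qed.

Lemma ImB x y : complex.Im (x - y) = complex.Im x - complex.Im y.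
Proof. by case: x => a b; case: y => c d; rewrite /=. Qed.

Lemma normr_Re_le x : `|complex.Re x| <= normc x.
Proof.
case: x => a b /=; rewrite -sqrtr_sqr ler_sqrt ?lerDl ?sqr_ge0 //.
by rewrite addr_ge0 ?sqr_ge0.
Qed.

Lemma normr_Im_le x : `|complex.Im x| <= normc x.
Proof.
case: x => a b /=; rewrite -sqrtr_sqr ler_sqrt ?lerDr ?sqr_ge0 //.
by rewrite addr_ge0 ?sqr_ge0.
Qed.

Lemma normc_le_ReIm x : normc x <= `|complex.Re x| + `|complex.Im x|.
Proof.
case: x => a b /=; rewrite -(ler_pXn2r (_ : 0 < 2)%N) ?nnegrE ?addr_ge0 //.
rewrite sqr_sqrtr ?addr_ge0 ?sqr_ge0 // sqrrD !real_normK ?num_real //.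
by rewrite lerD2r lerDl mulrn_wge0 // mulr_ge0.
Qed.

Lemma normc_real (a : R) : normc a%:C%C = `|a|.
Proof. by rewrite /= expr0n /= addr0 sqrtr_sqr. Qed.

End Modulus.

(** * The maximal row sum norm *)

Section RowSumNorm.
Variable R : rcfType.
Implicit Types n : nat.

(** The operator norm for the sup norm on column vectors. It is real-valued and submultiplicative,
    unlike the entrywise maximum [mx_norm], which carries the topology. *)
Definition rownorm n (A : 'M[R[i]]_n) : R :=
  \big[Num.max/0]_(i < n) \sum_(j < n) normc (A i j).

Lemma rowsum_le n (A : 'M[R[i]]_n) i :
  \sum_(j < n) normc (A i j) <= rownorm A.
Proof. exact: le_bigmax. Qed.

Lemma rownorm_ge0 n (A : 'M[R[i]]_n) : 0 <= rownorm A.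
Proof. exact: bigmax_ge_id. Qed.

Lemma rownorm_le n (A : 'M[R[i]]_n) c : 0 <= c ->
  (forall i, \sum_(j < n) normc (A i j) <= c) -> rownorm A <= c.
Proof. by move=> c0 Ac; apply/bigmax_leP; split. Qed.

Lemma normc_le_rownorm n (A : 'M[R[i]]_n) i j : normc (A i j) <= rownorm A.
Proof.
apply: le_trans (rowsum_le A i); rewrite (bigD1 j) //= lerDl.
by apply: sumr_ge0 => *; exact: normc_ge0.
Qed.

Lemma rownorm0_eq0 n (A : 'M[R[i]]_n) : rownorm A = 0 -> A = 0.
Proof.
move=> A0; apply/matrixP => i j; rewrite mxE; apply: eq0_normc; apply/eqP.
by rewrite eq_le normc_ge0 andbT -A0 normc_le_rownorm.
Qed.

Lemma rownormD n (A B : 'M[R[i]]_n) :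
  rownorm (A + B) <= rownorm A + rownorm B.
Proof.
apply: rownorm_le => [|i]; first by rewrite addr_ge0 ?rownorm_ge0.
rewrite (le_trans _ (lerD (rowsum_le A i) (rowsum_le B i))) // -big_split /=.
by apply: ler_sum => j _; rewrite mxE normcD.
Qed.

Lemma rownormZ_le n c (A : 'M[R[i]]_n) :
  rownorm (c *: A) <= normc c * rownorm A.
Proof.
apply: rownorm_le => [|i]; first by rewrite mulr_ge0 ?normc_ge0 ?rownorm_ge0.
rewrite (le_trans _ (ler_wpM2l (normc_ge0 c) (rowsum_le A i))) // mulr_sumr.
by apply: ler_sum => j _; rewrite mxE normcM.
Qed.

(** For c != 0 the missing inequality is [rownormZ_le] for the scalar c^-1 and the matrix c A. *)
Lemma rownormZ n c (A : 'M[R[i]]_n) : rownorm (c *: A) = normc c * rownorm A.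
Proof.
apply/eqP; rewrite eq_le rownormZ_le /=.
have [->|c0] := eqVneq c 0; first by rewrite normc0 mul0r rownorm_ge0.
rewrite -ler_pdivlMl ?normc_gt0 // -normcV.
by rewrite (le_trans _ (rownormZ_le _ _)) // scalerA mulVf // scale1r.
Qed.

Lemma rownormM n (A B : 'M[R[i]]_n) :
  rownorm (A *m B) <= rownorm A * rownorm B.
Proof.
apply: rownorm_le => [|i]; first by rewrite mulr_ge0 ?rownorm_ge0.
rewrite (le_trans _ (ler_wpM2r (rownorm_ge0 B) (rowsum_le A i))) // mulr_suml.
under eq_bigr do rewrite mxE.
rewrite (le_trans (ler_sum _ (fun j _ => normc_sum _ _))) // exchange_big /=.
apply: ler_sum => k _; under eq_bigr do rewrite normcM.
by rewrite -mulr_sumr ler_wpM2l ?normc_ge0 ?rowsum_le.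
Qed.

Lemma rownorm1 n : rownorm (1%:M : 'M[R[i]]_n) <= 1.
Proof.
apply: rownorm_le => // i; rewrite (bigD1 i) //= mxE eqxx normc1.
rewrite big1 ?addr0 // => j ji; rewrite mxE eq_sym (negPf ji).
exact: normc0.
Qed.

Lemma rownorm_le_sum n (A : 'M[R[i]]_n) :
  rownorm A <= \sum_i \sum_j normc (A i j).
Proof.
apply: rownorm_le => [|i].
  by apply: sumr_ge0 => i _; apply: sumr_ge0 => j _; exact: normc_ge0.
rewrite [leRHS](bigD1 i) //= lerDl.
by apply: sumr_ge0 => j _; apply: sumr_ge0 => k _; exact: normc_ge0.
Qed.

End RowSumNorm.

(** * Convergence of matrices in terms of the row sum norm *)

Section MatrixTopology.
Variable R : realType.
Implicit Types n : nat.

Lemma mx_norm_le_rownorm n (A : 'M[R[i]]_n) : `|A| <= (rownorm A)%:C%C.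
Proof.
have [A0|A0] := eqVneq (mx_norm A) 0.
  by rewrite /Num.norm /= A0 lecR rownorm_ge0.
rewrite /Num.norm /=; have [ij ->] := mx_norm_neq0 A0.
by rewrite normr_normc lecR normc_le_rownorm.
Qed.

Lemma entry_le_mx_norm n (A : 'M[R[i]]_n) i j : `|A i j| <= `|A|.
Proof.
rewrite [leRHS]/Num.norm /= mx_normE -[leLHS]nngE num_le.
exact: (le_bigmax _ (fun ij => `|A ij.1 ij.2|%:nng) (i, j)).
Qed.

(** The row sum norm is at most the sum of the n^2 entry moduli, each of which is at most the
    maximum. *)
Lemma rownorm_le_mx_norm n (A : 'M[R[i]]_n) :
  (rownorm A)%:C%C <= n%:R * (n%:R * `|A|).
Proof.
have := rownorm_le_sum A; rewrite -lecR => /le_trans; apply.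
rewrite rmorph_sum /= mulr_natl -[n in _ *+ n]card_ord -sumr_const.
apply: ler_sum => i _; rewrite rmorph_sum /= mulr_natl.
rewrite -[n in _ *+ n]card_ord -sumr_const; apply: ler_sum => j _.
exact: entry_le_mx_norm.
Qed.

(** The order on [R[i]] compares only numbers with equal imaginary parts, so every positive epsilon
    there is real. This lets epsilons pass between [R[i]] and [R]. *)
Lemma complex_pos_real (e : R[i]) : 0 < e -> e = (complex.Re e)%:C%C.
Proof. by case: e => a b; rewrite ltcE /= => /andP[/eqP ->]. Qed.

(** Reduces matrix convergence to convergence of a real function to 0, where squeezing is
    available. *)
Lemma cvg_rownormP (T : Type) (F : set_system T) {FF : Filter F} n
    (f : T -> 'M[R[i]]_n) (A : 'M[R[i]]_n) :
  f @ F --> A <-> rownorm (f x - A) @[x --> F] --> (0 : R).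
Proof.
split.
  move=> /cvgrPdist_lt fA; apply/cvgrPdist_lt => e e0.
  (* Dividing by n + 1 instead of n also covers matrices of size 0. *)
  have n0 : 0 < n.+1%:R :> R by [].
  have /fA : 0 < (e / n.+1%:R / n.+1%:R)%:C%C by rewrite ltcR !divr_gt0.
  apply: filterS => x Hx; rewrite sub0r normrN ger0_norm ?rownorm_ge0 //.
  rewrite -ltcR (le_lt_trans (rownorm_le_mx_norm _)) //.
  rewrite -normrN opprB.
  apply: (@le_lt_trans _ _ (n.+1%:R * (n.+1%:R * `|A - f x|))).
    by rewrite !ler_pM ?mulr_ge0 ?ler_nat.
  rewrite mulrA -ltr_pdivlMl ?mulr_gt0 ?ltr0n //.
  rewrite (lt_le_trans Hx) // !rmorphM /= !fmorphV /= !rmorph_nat.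
  by rewrite invfM [leRHS]mulrC mulrA.
move=> /cvgrPdist_lt fA; apply/cvgrPdist_lt => e e0.
have e0' : 0 < complex.Re e by rewrite -ltcR -complex_pos_real.
have := fA _ e0'; apply: filterS => x.
rewrite sub0r normrN ger0_norm ?rownorm_ge0 // -ltcR -complex_pos_real // => H.
by rewrite -normrN opprB (le_lt_trans (mx_norm_le_rownorm _)).
Qed.

Lemma cvg_normcP (T : Type) (F : set_system T) {FF : Filter F}
    (f : T -> R[i]) (a : R[i]) :
  f @ F --> a <-> normc (f x - a) @[x --> F] --> (0 : R).
Proof.
split.
  move=> /cvgrPdist_lt fA; apply/cvgrPdist_lt => e e0.
  have /fA : 0 < e%:C%C by rewrite ltcR.
  apply: filterS => x; rewrite -[`|_|]/((normc _)%:C%C) ltcR normc_distC.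
  by rewrite sub0r normrN ger0_norm ?normc_ge0.
move=> /cvgrPdist_lt fA; apply/cvgrPdist_lt => e e0.
have e0' : 0 < complex.Re e by rewrite -ltcR -complex_pos_real.
have := fA _ e0'; apply: filterS => x.
rewrite sub0r normrN ger0_norm ?normc_ge0 // -ltcR -complex_pos_real // => H.
by rewrite -[`|_|]/((normc _)%:C%C) normc_distC.
Qed.

Lemma cvg_entry (T : Type) (F : set_system T) {FF : Filter F} n
    (f : T -> 'M[R[i]]_n) (A : 'M[R[i]]_n) i j :
  f @ F --> A -> f x i j @[x --> F] --> A i j.
Proof.
move=> /cvg_rownormP fA; apply/cvg_normcP.
apply: squeeze_cvgr fA; last exact: cvg_cst.
near=> x; rewrite normc_ge0 (le_trans _ (normc_le_rownorm _ i j)) //.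
by rewrite !mxE.
Unshelve. all: by end_near. Qed.

Lemma cvg_mxl (T : Type) (F : set_system T) {FF : Filter F} n
    (f : T -> 'M[R[i]]_n) (A B : 'M[R[i]]_n) :
  f @ F --> A -> B *m f x @[x --> F] --> B *m A.
Proof.
move=> /cvg_rownormP fA; apply/cvg_rownormP.
have : rownorm B * rownorm (f x - A) @[x --> F] --> rownorm B * 0.
  exact: cvgMl_tmp.
rewrite mulr0; apply: squeeze_cvgr; last exact: cvg_cst.
by near=> x; rewrite rownorm_ge0 /= -mulmxBr rownormM.
Unshelve. all: by end_near. Qed.

Lemma cvg_mxr (T : Type) (F : set_system T) {FF : Filter F} n
    (f : T -> 'M[R[i]]_n) (A B : 'M[R[i]]_n) :
  f @ F --> A -> f x *m B @[x --> F] --> A *m B.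
Proof.
move=> /cvg_rownormP fA; apply/cvg_rownormP.
have : rownorm (f x - A) * rownorm B @[x --> F] --> 0 * rownorm B.
  exact: cvgMr_tmp.
rewrite mul0r; apply: squeeze_cvgr; last exact: cvg_cst.
by near=> x; rewrite rownorm_ge0 /= -mulmxBl rownormM.
Unshelve. all: by end_near. Qed.

End MatrixTopology.

(** * Differentiability from a quadratic remainder *)

Section QuadraticRemainder.
Variables (K : numFieldType) (V W : normedModType K).

(** A remainder of size C |h|^2 is o(h), and a bounded linear map is continuous, so [L] is the
    differential. Both the inverse and the power series are treated through this criterion. *)
Lemma differentiable_quadratic (f L : V -> W) (x : V) (C d : K) :
  0 < d -> 0 < C -> linear L -> (forall h, `|L h| <= C * `|h|) ->
  (forall h, `|h| <= d -> `|f (h + x) - f x - L h| <= C * `|h| ^+ 2) ->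
  differentiable f x.
Proof.
move=> d0 C0 linL bL rem.
pose L' : {linear V -> W} := HB.pack L (GRing.isLinear.Build _ _ _ _ L linL).
have cL : continuous L'.
  apply: bounded_linear_continuous; apply/linear_boundedP.
  near=> r => h; rewrite (le_trans (bL h)) // ler_wpM2r //.
  by near: r; apply: nbhs_pinfty_ge; rewrite gtr0_real.
have fL : f \o shift x = cst (f x) + L' +o_0 id.
  apply/eqaddoP => e e0; near=> h.
  have hd : `|h| <= d by near: h; exact: nbhs0_le.
  rewrite /= opprD addrA (le_trans (rem h hd)) //.
  rewrite expr2 mulrA ler_wpM2r // -ler_pdivlMl //.
  by near: h; apply: nbhs0_le; rewrite mulr_gt0 ?invr_gt0.
by apply/diff_locallyP; rewrite (diff_unique cL fL).
Unshelve. all: by end_near. Qed.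

End QuadraticRemainder.

(** * Equivalence of matrix norms on 2 x 2 matrices *)

Section NormEquivalence.
Variable R : realType.

Lemma cvg_lipschitz_rownorm n (f : 'M[R[i]]_n -> R) (C : R) (A : 'M[R[i]]_n) :
  (forall X Y, `|f X - f Y| <= C * rownorm (X - Y)) ->
  f X @[X --> A] --> f A.
Proof.
move=> Cf; have FA : Filter (nbhs A) := nbhs_filter A.
apply/subr_cvg0/norm_cvg0P.
have AA : rownorm (X - A) @[X --> A] --> (0 : R).
  exact: (proj1 (cvg_rownormP (F := nbhs A) id A) cvg_id).
have : C * rownorm (X - A) @[X --> A] --> C * 0 by exact: cvgMl_tmp.
rewrite mulr0 => CA; apply: (squeeze_cvgr _ (cvg_cst 0) CA).
by near=> X; rewrite normr_ge0 /= Cf.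
Unshelve. all: by end_near. Qed.

(** A square takes the place of the closed disk: it is the continuous image of a product of two
    segments, hence compact. *)
Definition square (r : R) : set R[i] :=
  [set (xy.1 +i* xy.2)%C | xy in `[- r, r]%classic `*` `[- r, r]%classic].

Lemma compact_square r : compact (square r).
Proof.
apply: continuous_compact; last by apply: compact_setX; exact: segment_compact.
apply: continuous_subspaceT => /= xy.
have FF : Filter (nbhs xy) := nbhs_filter xy.
apply/cvg_normcP.
have cx : `|uv.1 - xy.1| @[uv --> xy] --> (0 : R).
  by apply/norm_cvg0P/subr_cvg0; exact: cvg_fst.
have cy : `|uv.2 - xy.2| @[uv --> xy] --> (0 : R).
  by apply/norm_cvg0P/subr_cvg0; exact: cvg_snd.
have cxy : `|uv.1 - xy.1| + `|uv.2 - xy.2| @[uv --> xy] --> (0 : R).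
  by rewrite -[X in _ --> X]addr0; exact: cvgD.
apply: (squeeze_cvgr _ (cvg_cst 0) cxy).
by near=> uv; rewrite normc_ge0 (le_trans (normc_le_ReIm _)).
Unshelve. all: by end_near. Qed.

Lemma in_square r z : normc z <= r -> square r z.
Proof.
move=> zr; exists (complex.Re z, complex.Im z); last by case: (z).
split; rewrite /= in_itv /= -ler_norml (le_trans _ zr) //.
- exact: normr_Re_le.
- exact: normr_Im_le.
Qed.

Lemma continuous_bounded_disk (f : R[i] -> R) (r : R) : continuous f ->
  exists B, forall z, normc z <= r -> `|f z| <= B.
Proof.
move=> cf; have [r0|r0] := ltP r 0.
  by exists 0 => z /(le_trans (normc_ge0 z)); rewrite leNgt r0.
have ne : square r !=set0 by exists 0; apply: in_square; rewrite normc0.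
have [|c _ cmax] := compact_EVT_max ne (@compact_square r) (f := fun z => `|f z|).
  apply: continuous_subspaceT => /= z.
  have FF : Filter (nbhs z) := nbhs_filter z.
  by apply: cvg_norm; exact: cf.
by exists `|f c| => z /in_square zr; apply: cmax; rewrite inE.
Qed.

Section MatrixNorm.
Variable N : 'M[R[i]]_2 -> R.
Hypothesis hN : is_matrix_norm N.

Lemma matrix_normD A B : N (A + B) <= N A + N B. Proof. by case: hN. Qed.

Lemma matrix_normZ c A : N (c *: A) = normc c * N A. Proof. by case: hN. Qed.

Lemma matrix_norm0_eq0 A : N A = 0 -> A = 0. Proof. by case: hN => h _ _; exact: h. Qed.

Lemma matrix_normN A : N (- A) = N A.
Proof. by rewrite -scaleN1r matrix_normZ normcN normc1 mul1r. Qed.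

Lemma matrix_norm0 : N 0 = 0.
Proof. by rewrite -(scale0r (0 : 'M[R[i]]_2)) matrix_normZ normc0 mul0r. Qed.

Lemma matrix_norm_ge0 A : 0 <= N A.
Proof.
have := matrix_normD A (- A); rewrite subrr matrix_norm0 matrix_normN.
by rewrite -mulr2n pmulrn_lge0.
Qed.

Lemma matrix_norm_gt0 A : A != 0 -> 0 < N A.
Proof.
move=> A0; rewrite lt_def matrix_norm_ge0 andbT.
by apply: contra A0 => /eqP/matrix_norm0_eq0 ->.
Qed.

Lemma matrix_norm_distr A B : `|N A - N B| <= N (A - B).
Proof.
rewrite ler_norml lerBlDr -[X in N X <= _](subrK B) matrix_normD andbT.
rewrite lerNl opprB lerBlDr -[X in N X <= _](subrK A) -[X in _ <= X + _]matrix_normN opprB.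
exact: matrix_normD.
Qed.

Lemma matrix_norm_le_rownorm : exists2 C, 0 < C & forall A, N A <= C * rownorm A.
Proof.
(* Expanding [A] in the elementary matrices bounds [N A] with this constant; adding 1 makes it
   positive. *)
pose C := \sum_(i < 2) \sum_(j < 2) N (delta_mx i j).
have C0 : 0 <= C.
  by apply: sumr_ge0 => i _; apply: sumr_ge0 => j _; exact: matrix_norm_ge0.
exists (C + 1) => [|A]; first by rewrite ltr_pwDr.
apply: (@le_trans _ _ (C * rownorm A)); last first.
  by rewrite ler_wpM2r ?rownorm_ge0 // lerDl.
rewrite [X in N X]matrix_sum_delta /C mulr_suml.
have Nsum (F : 'I_2 -> 'M[R[i]]_2) : N (\sum_i F i) <= \sum_i N (F i).
  elim/big_ind2 : _ => [|X a Y b Xa Yb|//]; first by rewrite matrix_norm0.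
  by rewrite (le_trans (matrix_normD _ _)) // lerD.
rewrite (le_trans (Nsum _)) //; apply: ler_sum => i _; rewrite mulr_suml.
rewrite (le_trans (Nsum _)) //; apply: ler_sum => j _.
by rewrite matrix_normZ mulrC ler_wpM2l ?matrix_norm_ge0 ?normc_le_rownorm.
Qed.

(** [N] is continuous and attains its minimum on the compact unit sphere of [rownorm]. The minimum
    is positive because 0 is not on the sphere, and homogeneity extends the bound to all matrices.
    Matrices are flattened to row vectors, where a product of compact squares is compact. *)
Lemma rownorm_le_matrix_norm : exists2 c, 0 < c & forall A, c * rownorm A <= N A.
Proof.
have [C C0 NC] := matrix_norm_le_rownorm.
pose K := [set v : 'rV[R[i]]_(2 * 2) | forall i, square 1 (v ord0 i)].
have cK : compact K.
  exact: (@rV_compact _ _ (fun=> square 1) (fun=> @compact_square 1)).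
have FF (v : 'rV[R[i]]_(2 * 2)) : Filter (nbhs v) := nbhs_filter v.
(* Flattening only reindexes the entries, so it does not increase the maximum norm. *)
have cvec (v : 'rV[R[i]]_(2 * 2)) : vec_mx w @[w --> v] --> (vec_mx v : 'M[R[i]]_2).
  apply/cvgrPdist_le => e e0; near=> w.
  rewrite -linearB /= [leLHS]/Num.norm /=.
  have [->|/mx_norm_neq0 [ij ->]] := eqVneq (mx_norm (vec_mx (v - w) : 'M[R[i]]_2)) 0.
    exact: ltW.
  rewrite mxE; apply: (@le_trans _ _ `|v - w|).
    rewrite [leRHS]/Num.norm /= mx_normE -[leLHS]nngE num_le.
    exact: (le_bigmax _ (fun ij => `|(v - w) ij.1 ij.2|%:nng) (0, mxvec_index ij.1 ij.2)).
  near: w; exact: cvgr_dist_le.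
have cN (f : 'M[R[i]]_2 -> R) D : (forall X Y, `|f X - f Y| <= D * rownorm (X - Y)) ->
    continuous (f \o vec_mx : 'rV[R[i]]_(2 * 2) -> R).
  move=> fD v; apply: (cvg_comp _ _ (cvec v)); exact: cvg_lipschitz_rownorm fD.
have c1 : continuous (@rownorm R 2 \o @vec_mx R[i] 2 2).
  apply: (cN _ 1) => X Y; rewrite mul1r ler_norml lerBlDr.
  rewrite -[X in rownorm X <= _](subrK Y) rownormD andbT lerNl opprB lerBlDr.
  rewrite -[X in rownorm X <= _](subrK X) (le_trans (rownormD _ _)) // lerD2r.
  by rewrite -(opprB X) -scaleN1r rownormZ normcN normc1 mul1r.
have cN' : continuous (N \o @vec_mx R[i] 2 2).
  by apply: (cN _ C) => X Y; rewrite (le_trans (matrix_norm_distr _ _)).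
pose S := K `&` [set v | rownorm (vec_mx v : 'M[R[i]]_2) = 1].
have cS : compact S.
  apply: compact_closedI => //.
  exact: (proj1 (continuous_closedP _) c1 _ (@closed_eq _ 1)).
have inS A : rownorm A = 1 -> S (mxvec A).
  move=> A1; split; last by rewrite /= mxvecK.
  move=> k; have [i j] := mxvec_indexP k.
  by rewrite mxvecE; apply: in_square; rewrite -A1 normc_le_rownorm.
have nz (A : 'M[R[i]]_2) : A != 0 -> 0 < rownorm A.
  move=> A0; rewrite lt_def rownorm_ge0 andbT; apply: contra A0 => /eqP A0.
  by rewrite (rownorm0_eq0 A0).
have normalised (A : 'M[R[i]]_2) : A != 0 -> rownorm (((rownorm A)^-1)%:C%C *: A) = 1.
  move=> /nz A0; rewrite rownormZ normc_real gtr0_norm ?invr_gt0 //.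
  by rewrite mulVf ?gt_eqF.
have [v vS vmin] : exists2 v, v \in S & forall w, w \in S -> N (vec_mx v) <= N (vec_mx w).
  apply: compact_EVT_min => //; last exact: continuous_subspaceT.
  (* The normalised identity shows that the sphere is not empty. *)
  exists (mxvec (((rownorm (1%:M : 'M[R[i]]_2))^-1)%:C%C *: 1%:M)); apply: inS.
  by apply: normalised; exact: (oner_neq0 'M[R[i]]_2).
have v0 : vec_mx v != 0 :> 'M[R[i]]_2.
  apply/eqP => v0; move: vS; rewrite inE => -[_ /=].
  rewrite v0 -(scale0r (0 : 'M[R[i]]_2)) rownormZ normc0 mul0r => /eqP.
  by rewrite eq_sym oner_eq0.
exists (N (vec_mx v)) => [|A]; first exact: matrix_norm_gt0.
have [->|A0] := eqVneq A 0.
  rewrite matrix_norm0 -(scale0r (0 : 'M[R[i]]_2)) rownormZ normc0 mul0r.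
  by rewrite mulr0.
have := vmin _ (mem_set (inS _ (normalised _ A0))).
rewrite mxvecK matrix_normZ normc_real gtr0_norm ?invr_gt0 ?nz // => H.
by rewrite -ler_pdivlMr ?nz // mulrC.
Unshelve. all: by end_near. Qed.

End MatrixNorm.
End NormEquivalence.

(** * Lower triangular matrices, conjugation and triangularisation *)

Section Triangular.
Variable R : realType.
Implicit Types (l c m z : R[i]) (S T A B M : 'M[R[i]]_2).

Definition lower2 l c m : 'M[R[i]]_2 :=
  \matrix_(i, j) if i == 0 then (if j == 0 then l else 0)
                 else (if j == 0 then c else m).

Lemma mx2P A B : A 0 0 = B 0 0 -> A 0 1 = B 0 1 -> A 1 0 = B 1 0 ->
  A 1 1 = B 1 1 -> A = B.
Proof.
move=> e00 e01 e10 e11; apply/matrixP.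
have ord2 (i : 'I_2) : i = 0 \/ i = 1.
  by case: i => -[|[|//]] p; [left|right]; apply/val_inj.
by move=> i j; case: (ord2 i) => ->; case: (ord2 j) => ->.
Qed.

Lemma lower2E A : is_trig_mx A -> A = lower2 (A 0 0) (A 1 0) (A 1 1).
Proof. by move=> /is_trig_mxP tA; apply: mx2P; rewrite !mxE // tA. Qed.

Lemma lower2M l c m l' c' m' :
  lower2 l c m *m lower2 l' c' m' = lower2 (l * l') (c * l' + m * c') (m * m').
Proof. by apply: mx2P; rewrite !mxE !big_ord_recl big_ord0 !mxE /=; ring. Qed.

Lemma lower2_1 : lower2 1 0 1 = 1%:M.
Proof. by apply: mx2P; rewrite !mxE. Qed.

Lemma lower2Z a l c m : a *: lower2 l c m = lower2 (a * l) (a * c) (a * m).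
Proof. by apply: mx2P; rewrite !mxE //= mulr0. Qed.

(* (l^k - m^k) / (l - m) for l != m, and the derivative k l^(k-1) for l = m. *)
Fixpoint power_diffquot l m k : R[i] :=
  if k is k'.+1 then power_diffquot l m k' * l + m ^+ k' else 0.

Lemma lower2X l c m k :
  lower2 l c m ^+ k = lower2 (l ^+ k) (c * power_diffquot l m k) (m ^+ k).
Proof.
elim: k => [|k IH] /=; first by rewrite !expr0 mulr0 lower2_1.
by rewrite exprSr IH -mulmxE lower2M !exprSr; congr lower2; ring.
Qed.

Lemma lower2_eigenvalue l c m z : eigenvalue (lower2 l c m) z = (z == l) || (z == m).
Proof.
have tr : is_trig_mx (lower2 l c m).
  by apply/is_trig_mxP => -[[|[|//]] p] [[|[|//]] q] //=; rewrite mxE.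
rewrite eigenvalue_root_char char_poly_trig // !big_ord_recl big_ord0 mulr1.
by rewrite rootM !root_XsubC !mxE.
Qed.

Lemma lower2_invmx l c m : l != 0 -> m != 0 ->
  invmx (lower2 l c m) = lower2 l^-1 (- (c / (l * m))) m^-1.
Proof.
move=> l0 m0; set T := lower2 l c m; set T' := lower2 _ _ _.
have TT' : T *m T' = 1%:M.
  rewrite lower2M -lower2_1; congr lower2; field; rewrite ?l0 ?m0 //.
by have [uT _] := mulmx1_unit TT'; rewrite -[LHS]mulmx1 -TT' mulKmx.
Qed.

Definition conj2 S A := invmx S *m A *m S.

Lemma conj2M S A B : S \in unitmx -> conj2 S A *m conj2 S B = conj2 S (A *m B).
Proof. by move=> uS; rewrite /conj2 !mulmxA mulmxK. Qed.

Lemma conj2_1 S : S \in unitmx -> conj2 S 1%:M = 1%:M.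
Proof. by move=> uS; rewrite /conj2 mulmx1 mulVmx. Qed.

Lemma conj2D S A B : conj2 S (A + B) = conj2 S A + conj2 S B.
Proof. by rewrite /conj2 mulmxDr mulmxDl. Qed.

Lemma conj2Z S a A : conj2 S (a *: A) = a *: conj2 S A.
Proof. by rewrite /conj2 -scalemxAr -scalemxAl. Qed.

Lemma conj2_sum S (I : Type) (s : seq I) (P : pred I) (F : I -> 'M[R[i]]_2) :
  conj2 S (\sum_(i <- s | P i) F i) = \sum_(i <- s | P i) conj2 S (F i).
Proof. by rewrite /conj2 mulmx_sumr mulmx_suml. Qed.

Lemma conj2X S A k : S \in unitmx -> conj2 S (A ^+ k) = conj2 S A ^+ k.
Proof.
move=> uS; elim: k => [|k IH]; first by rewrite !expr0 -[1]/(1%:M) conj2_1.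
by rewrite !exprS -!mulmxE -conj2M // IH.
Qed.

Lemma conj2_inv S A : S \in unitmx -> A \in unitmx ->
  invmx (conj2 S A) = conj2 S (invmx A).
Proof.
move=> uS uA.
have e : conj2 S A *m conj2 S (invmx A) = 1%:M by rewrite conj2M // mulmxV ?conj2_1.
by have [uc _] := mulmx1_unit e; rewrite -[LHS]mulmx1 -e mulKmx.
Qed.

Lemma conj2K S : S \in unitmx -> cancel (conj2 S) (conj2 (invmx S)).
Proof.
by move=> uS A; rewrite /conj2 invmxK !mulmxA mulmxV // mul1mx mulmxK.
Qed.

Lemma invmx_mul S T : S \in unitmx -> T \in unitmx ->
  invmx (T *m S) = invmx S *m invmx T.
Proof.
move=> uS uT; have uTS : T *m S \in unitmx by rewrite unitmx_mul uT.
have e : (T *m S) *m (invmx S *m invmx T) = 1%:M by rewrite mulmxA mulmxK // mulmxV.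
by rewrite -[LHS]mulmx1 -e mulKmx.
Qed.

Lemma conj2_comp S T A : S \in unitmx -> T \in unitmx ->
  conj2 S (conj2 T A) = conj2 (T *m S) A.
Proof. by move=> uS uT; rewrite /conj2 invmx_mul // !mulmxA. Qed.

Lemma conj2_eigenvalue S A z : S \in unitmx ->
  eigenvalue (conj2 S A) z = eigenvalue A z.
Proof.
move=> uS; apply/eigenvalueP/eigenvalueP => -[v vA v0].
  exists (v *m invmx S).
    have : v *m conj2 S A *m invmx S = (z *: v) *m invmx S by rewrite vA.
    by rewrite /conj2 !mulmxA mulmxK // scalemxAl.
  by apply: contra v0 => /eqP v0; rewrite -(mulmxKV uS v) v0 mul0mx.
exists (v *m S); first by rewrite /conj2 !mulmxA mulmxK // vA scalemxAl.
by apply: contra v0 => /eqP v0; rewrite -(mulmxK uS v) v0 mul0mx.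
Qed.

(** Schur's theorem, whose triangular form is lower triangular here; the unitary matrix is used only
    as an invertible one. *)
Lemma triangularisation A :
  exists S l c m, S \in unitmx /\ A = conj2 S (lower2 l c m).
Proof.
have [P /unitarymx_unit uP] := @Schur R[i] 2 A isT.
rewrite /similar_to /= conjumx // => /lower2E tA.
set B := P *m A *m invmx P in tA; exists P, (B 0 0), (B 1 0), (B 1 1).
by split=> //; rewrite -tA /conj2 /B !mulmxA mulVmx // mul1mx mulmxKV.
Qed.

Lemma rownorm_lower2 l c m :
  rownorm (lower2 l c m) <= Num.max (normc l) (normc c + normc m).
Proof.
apply: rownorm_le => [|i]; first by rewrite le_max normc_ge0.
rewrite !big_ord_recl big_ord0 addr0 !mxE /=.
have n0 : normc 0 = 0 :> R by exact: normc0.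
by case: (i == 0); rewrite ?n0 ?addr0 le_max lexx ?orbT.
Qed.

(* Conjugating by diag(1, e) multiplies the off-diagonal entry by e. *)
Lemma adapted_conj A (q : R) : (forall z, eigenvalue A z -> normc z < q) ->
  exists2 S, S \in unitmx & rownorm (conj2 (invmx S) A) < q.
Proof.
have [S [l [c [m [uS ->]]]]] := triangularisation A => eA.
have lq : normc l < q by apply: eA; rewrite conj2_eigenvalue // lower2_eigenvalue eqxx.
have mq : normc m < q.
  by apply: eA; rewrite conj2_eigenvalue // lower2_eigenvalue eqxx orbT.
pose e := (q - normc m) / (normc c + 1).
have c1 : 0 < normc c + 1 by rewrite ltr_pwDr ?normc_ge0.
have e0 : 0 < e by rewrite divr_gt0 ?subr_gt0.
pose D := lower2 1 0 e%:C%C.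
have eC0 : e%:C%C != 0 by rewrite -normc_eq0 normc_real gtr0_norm // gt_eqF.
have uD : D \in unitmx.
  have e1 : D *m lower2 1 0 (e%:C%C)^-1 = 1%:M.
    by rewrite lower2M -lower2_1 !(mulr1, mul1r, mulr0, addr0) mulfV.
  by have [] := mulmx1_unit e1.
exists (D *m S); first by rewrite unitmx_mul uD.
rewrite invmx_mul // -conj2_comp ?unitmx_inv // conj2K //.
have -> : conj2 (invmx D) (lower2 l c m) = lower2 l (e%:C%C * c) m.
  rewrite /conj2 invmxK /D lower2_invmx ?oner_neq0 // !lower2M.
  by congr lower2; field.
rewrite (le_lt_trans (rownorm_lower2 _ _ _)) // gt_max lq /= normcM.
rewrite normc_real gtr0_norm // -ltrBrDr /e mulrAC ltr_pdivrMr //.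
by rewrite ltr_pM2l ?subr_gt0 // ltrDl.
Qed.

End Triangular.

(** * Geometrically bounded matrix series, and differentiability in an arbitrary norm *)

Section Completeness.
Variable R : realType.

Lemma geometric_sum_le (x : R) n : 0 <= x < 1 ->
  \sum_(0 <= k < n) x ^+ k <= (1 - x)^-1.
Proof.
move=> /andP[x0 x1]; have x1' : 0 < 1 - x by rewrite subr_gt0.
rewrite -[leRHS]mul1r ler_pdivlMr // mulrC big_mkord.
by rewrite -opprB mulNr -subrX1 opprB gerBl exprn_ge0.
Qed.

Lemma geometric_bound_cvg (u : nat -> R) (C x : R) : 0 <= x < 1 ->
  (forall k, `|u k| <= C * x ^+ k) -> cvgn (series u).
Proof.
move=> /andP[x0 x1] uC; apply: normed_cvg.
have C0 : 0 <= C by have := uC 0%N; rewrite expr0 mulr1; apply: le_trans.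
apply: (@series_le_cvg _ _ (geometric C x)) => [n|n|n|] //=.
- by rewrite mulr_ge0 ?exprn_ge0.
- by apply: is_cvg_geometric_series; rewrite ger0_norm.
Qed.

Lemma cvg_rownorm_bound n (T : Type) (F : set_system T) {FF : ProperFilter F}
    (f : T -> 'M[R[i]]_n) (A : 'M[R[i]]_n) (nu : 'M[R[i]]_n -> R) (C c : R) :
  (forall X Y, `|nu X - nu Y| <= C * rownorm (X - Y)) ->
  f @ F --> A -> (forall x, nu (f x) <= c) -> nu A <= c.
Proof.
move=> nuC fA fc.
have nuA : nu (f x) @[x --> F] --> nu A.
  exact: (cvg_comp _ _ fA (cvg_lipschitz_rownorm nuC)).
exact: (cvgr_to_le nuA (nearW _ fc)).
Qed.

(** The limit is assembled from the real and imaginary parts of the entries, each of which is an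
    absolutely convergent real series. *)
Lemma rownorm_geometric_cvg n (t : nat -> 'M[R[i]]_n) (C x : R) : 0 <= x < 1 ->
  (forall k, rownorm (t k) <= C * x ^+ k) ->
  exists l : 'M[R[i]]_n, series t @ \oo --> l.
Proof.
move=> x01 tC.
have cRe i j : cvgn (series (fun k => complex.Re (t k i j))).
  apply: (geometric_bound_cvg x01) => k.
  by rewrite (le_trans (normr_Re_le _)) // (le_trans (normc_le_rownorm _ i j)).
have cIm i j : cvgn (series (fun k => complex.Im (t k i j))).
  apply: (geometric_bound_cvg x01) => k.
  by rewrite (le_trans (normr_Im_le _)) // (le_trans (normc_le_rownorm _ i j)).
pose l i j := (limn (series (fun k => complex.Re (t k i j)))
            +i* limn (series (fun k => complex.Im (t k i j))))%C.
exists (\matrix_(i, j) l i j); apply/cvg_rownormP.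
have ReS (I : Type) (r : seq I) (f : I -> R[i]) :
    complex.Re (\sum_(k <- r) f k) = \sum_(k <- r) complex.Re (f k).
  by apply: (big_morph (@complex.Re R)) => // -[a b] [c d].
have ImS (I : Type) (r : seq I) (f : I -> R[i]) :
    complex.Im (\sum_(k <- r) f k) = \sum_(k <- r) complex.Im (f k).
  by apply: (big_morph (@complex.Im R)) => // -[a b] [c d].
pose e i j m := `|series (fun k => complex.Re (t k i j)) m - complex.Re (l i j)|
  + `|series (fun k => complex.Im (t k i j)) m - complex.Im (l i j)|.
have e0 i j : e i j @ \oo --> (0 : R).
  rewrite -[X in _ --> X]addr0; apply: cvgD; apply/norm_cvg0P/subr_cvg0.
  - exact: cRe.
  - exact: cIm.
have E0 : (\sum_i \sum_j e i j m) @[m --> \oo] --> (0 : R).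
  rewrite -[X in _ --> X](@big1_eq R 0 +%R 'I_n (index_enum 'I_n) predT).
  apply: cvg_big => [|i _]; first exact: add_continuous.
  rewrite -[X in _ --> X](@big1_eq R 0 +%R 'I_n (index_enum 'I_n) predT).
  by apply: cvg_big => [|j _]; [exact: add_continuous|exact: e0].
apply: (squeeze_cvgr _ (cvg_cst 0) E0); near=> m.
rewrite rownorm_ge0 /= (le_trans (rownorm_le_sum _)) //.
apply: ler_sum => i _; apply: ler_sum => j _.
rewrite (le_trans (normc_le_ReIm _)) // !mxE ReB ImB seriesEnat /=.
by rewrite summxE ReS ImS.
Unshelve. all: by end_near. Qed.

Section Series.
Variable nu : 'M[R[i]]_2 -> R.
Hypothesis hnu : is_matrix_norm nu.

Lemma cvg_matrix_norm_bound (u : nat -> 'M[R[i]]_2) A c :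
  u @ \oo --> A -> (forall k, nu (u k) <= c) -> nu A <= c.
Proof.
have [C _ nuC] := matrix_norm_le_rownorm hnu.
apply: (@cvg_rownorm_bound _ _ _ _ _ _ _ C) => X Y.
exact: le_trans (matrix_norm_distr hnu _ _) (nuC _).
Qed.

Lemma matrix_norm_sum (I : Type) (r : seq I) (F : I -> 'M[R[i]]_2) :
  nu (\sum_(i <- r) F i) <= \sum_(i <- r) nu (F i).
Proof.
elim/big_ind2 : _ => [|X a Y b Xa Yb|//]; first by rewrite (matrix_norm0 hnu).
by rewrite (le_trans (matrix_normD hnu _ _)) // lerD.
Qed.

(** Norm equivalence yields existence of the sum; its size is then estimated in [nu] itself, so that
    no equivalence constant enters the bound. *)
Lemma matrix_series_cvg (t : nat -> 'M[R[i]]_2) (C x : R) : 0 <= x < 1 ->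
  (forall k, nu (t k) <= C * x ^+ k) ->
  exists2 l : 'M[R[i]]_2, series t @ \oo --> l & nu l <= C / (1 - x).
Proof.
move=> x01 tC; have [c c0 cnu] := rownorm_le_matrix_norm hnu.
have [l tl] : exists l : 'M[R[i]]_2, series t @ \oo --> l.
  apply: (@rownorm_geometric_cvg _ _ (C / c) _ x01) => k.
  by rewrite mulrAC ler_pdivlMr // mulrC (le_trans (cnu _)).
have C0 : 0 <= C.
  by have := tC 0%N; rewrite expr0 mulr1; apply: le_trans (matrix_norm_ge0 hnu _).
exists l => //; apply: (cvg_matrix_norm_bound tl) => k.
rewrite seriesEnat /= (le_trans (matrix_norm_sum _ _)) //.
apply: (@le_trans _ _ (\sum_(0 <= i < k) C * x ^+ i)).
  by apply: ler_sum => i _; exact: tC.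
by rewrite -mulr_sumr ler_wpM2l ?geometric_sum_le.
Qed.

(** Transports the quadratic remainder criterion to any matrix norm, in particular to one adapted to
    the point. *)
Lemma differentiable_matrix_norm (f L : 'M[R[i]]_2 -> 'M[R[i]]_2) X (C d : R) :
  0 < d -> 0 < C -> linear L -> (forall H, nu (L H) <= C * nu H) ->
  (forall H, nu H <= d -> nu (f (H + X) - f X - L H) <= C * nu H ^+ 2) ->
  differentiable f X.
Proof.
move=> d0 C0 linL bL rem; have [c c0 cnu] := rownorm_le_matrix_norm hnu.
have [c' c'0 nuc] := matrix_norm_le_rownorm hnu.
(* On 2 x 2 matrices the row sum norm is at most 2 * 2 times the maximum norm. *)
pose K := c' * 4.
have K0 : 0 < K by rewrite mulr_gt0.
have up A (a : R) : nu A <= a -> `|A| <= (c^-1 * a)%:C%C.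
  move=> Aa; rewrite (le_trans (mx_norm_le_rownorm _)) // lecR.
  by rewrite ler_pdivlMl // (le_trans (cnu _)).
have dn A : (nu A)%:C%C <= K%:C%C * `|A|.
  apply: (@le_trans _ _ (c'%:C%C * (rownorm A)%:C%C)); first by rewrite -rmorphM lecR.
  rewrite /K rmorphM /= -mulrA ler_wpM2l ?lecR ?(ltW c'0) //.
  rewrite (le_trans (rownorm_le_mx_norm _)) // mulrA rmorph_nat.
  by rewrite -natrM.
(* The factor c^-1 returns from [nu] to the maximum norm; K serves the linear bound and K^2 the
   quadratic one. The radius d / K below ensures nu H <= d. *)
pose D := c^-1 * C * (K + K ^+ 2).
have D0 : 0 < D by rewrite !mulr_gt0 ?invr_gt0 ?addr_gt0 ?exprn_gt0.
apply: (@differentiable_quadratic _ _ _ f L X D%:C%C (d / K)%:C%C).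
- by rewrite ltcR divr_gt0.
- by rewrite ltcR.
- exact: linL.
- move=> H; rewrite (le_trans (up _ _ (bL H))) // mulrA rmorphM /=.
  apply: (@le_trans _ _ ((c^-1 * C)%:C%C * (K%:C%C * `|H|))).
    by rewrite ler_wpM2l // lecR mulr_ge0 // ltW ?invr_gt0.
  rewrite mulrA -rmorphM ler_wpM2r // lecR /D ler_wpM2l ?lerDl ?exprn_ge0 ?(ltW K0) //.
  by rewrite ltW // mulr_gt0 ?invr_gt0.
- move=> H Hd.
  have nH : nu H <= d.
    rewrite -lecR (le_trans (dn H)) // (le_trans (ler_wpM2l _ Hd)) ?lecR ?(ltW K0) //.
    by rewrite -rmorphM lecR mulrC divfK ?gt_eqF.
  rewrite (le_trans (up _ _ (rem H nH))) // mulrA rmorphM /= rmorphXn /=.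
  apply: (@le_trans _ _ ((c^-1 * C)%:C%C * (K%:C%C * `|H|) ^+ 2)).
    rewrite ler_wpM2l // ?lecR ?mulr_ge0 ?invr_ge0 ?(ltW c0) ?(ltW C0) //.
    by rewrite ler_pXn2r ?nnegrE ?lecR ?(matrix_norm_ge0 hnu) ?mulr_ge0 ?lecR ?(ltW K0).
  rewrite exprMn mulrA -rmorphXn -rmorphM ler_wpM2r ?exprn_ge0 // lecR /D.
  by rewrite ler_wpM2l ?lerDr ?(ltW K0) // ltW // mulr_gt0 ?invr_gt0.
Qed.

End Series.
End Completeness.

(** * Power series of a matrix in a submultiplicative norm *)

Section PowerSeries.
Variable R : realType.
Variable nu : 'M[R[i]]_2 -> R.
Hypothesis hnu : is_matrix_norm nu.
Hypothesis nuM : forall A B, nu (A *m B) <= nu A * nu B.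
Hypothesis nu1 : nu 1 <= 1.
Implicit Types (W H : 'M[R[i]]_2) (b : nat -> R[i]).

Let nu_ge0 := matrix_norm_ge0 hnu.
Hint Resolve nu_ge0 : core.

Lemma matrix_normX A k : nu (A ^+ k) <= nu A ^+ k.
Proof.
elim: k => [|k IH]; first by rewrite !expr0.
by rewrite !exprS (le_trans (nuM _ _)) // ler_wpM2l.
Qed.

(* The derivative of [W ^+ k] at [W] in the direction [H]. *)
Fixpoint dexp W H k : 'M[R[i]]_2 :=
  if k is k'.+1 then dexp W H k' *m W + W ^+ k' *m H else 0.

Lemma dexp_linear W k : linear (dexp W ^~ k).
Proof.
move=> a X Y; elim: k => [|k IH] /=; first by rewrite scaler0 addr0.
rewrite IH mulmxDl mulmxDr -scalemxAl -scalemxAr scalerDr -!addrA.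
by congr (_ + _); rewrite addrCA.
Qed.

(** The recursion of the increment of the power has the same shape as that of [dexp], so subtracting
    the two recursions drives the inductions below. *)
Lemma exprSB_add W H k : (H + W) ^+ k.+1 - W ^+ k.+1 =
  ((H + W) ^+ k - W ^+ k) *m W + (H + W) ^+ k *m H.
Proof. by rewrite !exprSr -!mulmxE mulmxBl mulmxDr -addrA addrC. Qed.

Section Bounds.
Variables (W H : 'M[R[i]]_2) (d : R).
Hypothesis d0 : 0 < d.
Local Notation w := (nu W).
Local Notation h := (nu H).
Let wd0 : 0 <= w + d. Proof. by rewrite addr_ge0 // ltW. Qed.

Let W_le k : nu (W ^+ k) <= (w + d) ^+ k.
Proof.
by rewrite (le_trans (matrix_normX _ _)) // lerXn2r ?nnegrE // lerDl ltW.
Qed.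

(** In the recursion the first term contributes a factor w, and the second is h (w + d)^k = (h/d) (w
    + d)^k d; together they give the factor w + d. The estimates of the increment and of the
    remainder add up in the same way. *)
Lemma matrix_norm_dexp k : nu (dexp W H k) <= h / d * (w + d) ^+ k.
Proof.
elim: k => [|k IH] /=.
  by rewrite (matrix_norm0 hnu) mulr_ge0 // divr_ge0 // ltW.
rewrite (le_trans (matrix_normD hnu _ _)) // [_ ^+ k.+1]exprSr [in leRHS]mulrDr mulrDr.
rewrite lerD // (le_trans (nuM _ _)) //.
  by rewrite mulrA ler_wpM2r.
rewrite [leRHS](_ : _ = (w + d) ^+ k * h); last by field; rewrite gt_eqF.
by rewrite ler_wpM2r.
Qed.

Hypothesis hd : h <= d.

Lemma matrix_normX_add k : nu ((H + W) ^+ k) <= (w + d) ^+ k.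
Proof.
rewrite (le_trans (matrix_normX _ _)) // lerXn2r ?nnegrE //.
by rewrite (le_trans (matrix_normD hnu _ _)) // addrC lerD2l.
Qed.

Lemma matrix_normX_diff k :
  nu ((H + W) ^+ k - W ^+ k) <= h / d * (w + d) ^+ k.
Proof.
elim: k => [|k IH] /=.
  by rewrite !expr0 subrr (matrix_norm0 hnu) mulr_ge0 // divr_ge0 // ltW.
rewrite exprSB_add.
rewrite (le_trans (matrix_normD hnu _ _)) // [_ ^+ k.+1]exprSr [in leRHS]mulrDr mulrDr.
rewrite lerD // (le_trans (nuM _ _)) //.
  by rewrite mulrA ler_wpM2r.
rewrite [leRHS](_ : _ = (w + d) ^+ k * h); last by field; rewrite gt_eqF.
by rewrite ler_wpM2r ?matrix_normX_add.
Qed.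

(* In (w + h)^k the terms of degree j >= 2 in h are at most (h/d)^2 times those
   of (w + d)^k, since (h/d)^j <= (h/d)^2; the noncommutative remainder is
   dominated termwise. *)
Lemma matrix_normX_taylor k :
  nu ((H + W) ^+ k - W ^+ k - dexp W H k) <= (h / d) ^+ 2 * (w + d) ^+ k.
Proof.
elim: k => [|k IH] /=.
  rewrite !expr0 subrr subr0 (matrix_norm0 hnu) mulr1.
  by rewrite exprn_ge0 // divr_ge0 // ltW.
rewrite exprSB_add opprD addrACA -!mulmxBl.
rewrite (le_trans (matrix_normD hnu _ _)) // [_ ^+ k.+1]exprSr [in leRHS]mulrDr mulrDr.
rewrite lerD // (le_trans (nuM _ _)) //.
  by rewrite mulrA ler_wpM2r.
rewrite [leRHS](_ : _ = h / d * (w + d) ^+ k * h); last first.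
  by field; rewrite gt_eqF.
by rewrite ler_wpM2r ?matrix_normX_diff.
Qed.

End Bounds.

Definition mxseries b W : 'M[R[i]]_2 := lim (series (fun k => b k *: W ^+ k) @ \oo).

Section Sum.
Variables (b : nat -> R[i]) (B s : R).
Hypothesis bB : forall k, normc (b k) <= B * s ^+ k.

Let B0 : 0 <= B.
Proof. by have := bB 0%N; rewrite expr0 mulr1; apply: le_trans (normc_ge0 _). Qed.

Lemma matrix_norm_term (t : nat -> 'M[R[i]]_2) (c q : R) :
  (forall k, nu (t k) <= c * q ^+ k) ->
  forall k, nu (b k *: t k) <= B * c * (s * q) ^+ k.
Proof.
move=> tc k; rewrite (matrix_normZ hnu) exprMn mulrACA.
by rewrite ler_pM ?normc_ge0.
Qed.

Lemma cvg_mxseries W : 0 <= s -> s * nu W < 1 ->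
  series (fun k => b k *: W ^+ k) @ \oo --> mxseries b W.
Proof.
move=> s0 sW; have tW k : nu (W ^+ k) <= 1 * nu W ^+ k.
  by rewrite mul1r matrix_normX.
have x01 : 0 <= s * nu W < 1 by rewrite sW mulr_ge0.
have [l tl _] := matrix_series_cvg hnu x01 (matrix_norm_term tW).
by apply/cvg_ex; exists l.
Qed.

Lemma differentiable_mxseries W : 0 < s -> s * nu W < 1 ->
  differentiable (mxseries b) W.
Proof.
move=> s0 sW.
(* Half the gap between nu W and 1/s, which keeps s (nu W + d) below 1 and the majorants
   geometric. *)
pose d := (s^-1 - nu W) / 2.
have d0 : 0 < d by rewrite divr_gt0 // subr_gt0 -[s^-1]mul1r ltr_pdivlMr // mulrC.
pose x := s * (nu W + d).
have x1 : x < 1.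
  rewrite /x -ltr_pdivlMl // mulr1 -ltrBrDl /d ltr_pdivrMr //.
  by rewrite mulr2n mulrDr mulr1 ltrDl subr_gt0 -[s^-1]mul1r ltr_pdivlMr // mulrC.
have x01 : 0 <= x < 1 by rewrite x1 mulr_ge0 ?addr_ge0 ?(ltW s0) ?(ltW d0).
(* The candidate derivative is the termwise differentiated series; its sum is chosen together with a
   bound that is linear in nu H. *)
pose P H (l : 'M[R[i]]_2) := series (fun k => b k *: dexp W H k) @ \oo --> l
  /\ nu l <= B * (nu H / d) / (1 - x).
have /choice [L Lcvg] : forall H, exists l, P H l.
  move=> H; have := matrix_norm_term (@matrix_norm_dexp W H d d0).
  by case/(matrix_series_cvg hnu x01) => l; exists l.
have linL : linear L.
  move=> a X Y; apply: (@cvg_unique _ _ _ _ _ _ (proj1 (Lcvg _))) => //.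
  have cXY : a *: series (fun k => b k *: dexp W X k) n +
      series (fun k => b k *: dexp W Y k) n @[n --> \oo] --> a *: L X + L Y.
    by apply: cvgD (proj1 (Lcvg Y)); apply: cvgZl_tmp (proj1 (Lcvg X)).
  apply: (cvg_trans _ cXY); apply: near_eq_cvg; near=> n.
  rewrite /= !seriesEnat /= scaler_sumr -big_split /=; apply: eq_bigr => k _.
  by rewrite dexp_linear scalerDr !scalerA [a * _]mulrC.
(* The first two terms come from [matrix_norm_dexp] and [matrix_normX_taylor]; the 1 ensures
   positivity. *)
pose C := B * d^-1 / (1 - x) + B * d^-1 ^+ 2 / (1 - x) + 1.
have x1' : 0 < 1 - x by rewrite subr_gt0.
have C1 : 0 <= B * d^-1 / (1 - x) by rewrite !mulr_ge0 ?invr_ge0 ?(ltW x1') ?(ltW d0).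
have C2 : 0 <= B * d^-1 ^+ 2 / (1 - x).
  by rewrite !mulr_ge0 ?exprn_ge0 ?invr_ge0 ?(ltW x1') ?(ltW d0).
have C0 : 0 < C by rewrite ltr_pwDr ?addr_ge0.
apply: (@differentiable_matrix_norm _ _ hnu _ L W C d) => //.
  move=> H; rewrite (le_trans (proj2 (Lcvg H))) //.
  rewrite (_ : _ / _ = B * d^-1 / (1 - x) * nu H); last by ring.
  by rewrite ler_wpM2r // /C -addrA lerDl addr_ge0.
move=> H hd.
have [l tl lB] := matrix_series_cvg hnu x01 (matrix_norm_term (@matrix_normX_taylor W H d d0 hd)).
have sHW : s * nu (H + W) < 1.
  apply: le_lt_trans x1; rewrite ler_wpM2l ?(ltW s0) //.
  by rewrite (le_trans (matrix_normD hnu _ _)) // addrC lerD2l.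
have cB : series (fun k => b k *: (H + W) ^+ k) n - series (fun k => b k *: W ^+ k) n
    - series (fun k => b k *: dexp W H k) n @[n --> \oo] -->
    mxseries b (H + W) - mxseries b W - L H.
  apply: cvgB (proj1 (Lcvg H)); apply: cvgB; apply: cvg_mxseries => //; exact: ltW.
have seriesE : series (fun k => b k *: ((H + W) ^+ k - W ^+ k - dexp W H k)) =
    fun n => series (fun k => b k *: (H + W) ^+ k) n - series (fun k => b k *: W ^+ k) n
    - series (fun k => b k *: dexp W H k) n.
  apply/funext => n; rewrite !seriesEnat /= -!sumrB; apply: eq_bigr => k _.
  by rewrite !scalerBr.
rewrite seriesE in tl.
rewrite -(cvg_unique (@norm_hausdorff _ 'M[R[i]]_2) tl cB).
rewrite (le_trans lB) //.
rewrite (_ : _ / _ = B * d^-1 ^+ 2 / (1 - x) * nu H ^+ 2); last by ring.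
by rewrite ler_wpM2r ?exprn_ge0 // /C -addrA addrCA lerDl addr_ge0.
Unshelve. all: by end_near. Qed.

End Sum.
End PowerSeries.

(** * Differentiability of matrix inversion *)

Section Inverse.
Variable R : realType.
Implicit Types (M W H A : 'M[R[i]]_2).

Lemma is_matrix_norm_rownorm : is_matrix_norm (fun A : 'M[R[i]]_2 => rownorm A).
Proof.
split => [A|A B|c A]; [exact: rownorm0_eq0|exact: rownormD|exact: rownormZ].
Qed.

(** If K (1 + A) = 0 then K = - K A, so |K| <= |K| |A|, which forces K = 0 when |A| < 1. *)
Lemma unitmx_add1 A : rownorm A < 1 -> 1%:M + A \in unitmx.
Proof.
move=> A1; rewrite -row_free_unit -kermx_eq0; apply: contraLR A1 => K0.
set K := kermx (1%:M + A) in K0 *.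
have : K *m (1%:M + A) = 0 by exact: mulmx_ker.
rewrite mulmxDr mulmx1 => /eqP; rewrite addr_eq0 => /eqP KA.
have hrow := is_matrix_norm_rownorm.
have nK : rownorm K <= rownorm K * rownorm A.
  by rewrite {1}KA (matrix_normN hrow) rownormM.
rewrite -leNgt -(@ler_pM2l _ (rownorm K)) ?mulr1 //.
exact: (matrix_norm_gt0 hrow K0).
Qed.

(** With W' the inverse of H + M, the identity W' - W = - W' H W used twice gives the derivative - W
    H W and the remainder W' H W H W. *)
Lemma differentiable_invmx M : M \in unitmx ->
  differentiable (invmx : 'M[R[i]]_2 -> 'M[R[i]]_2) M.
Proof.
move=> uM; set W := invmx M; have hrow := is_matrix_norm_rownorm.
have W0 : W != 0.
  apply/eqP => W0; have := mulmxV uM; rewrite -/W W0 mulmx0 => /esym/eqP.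
  by rewrite (negPf (oner_neq0 'M[R[i]]_2)).
have w0 : 0 < rownorm W by exact: (matrix_norm_gt0 hrow W0).
(* This radius gives |H| |W| <= 1/2, whence H + M is invertible and |W'| <= 2 |W|. *)
pose d := (2 * rownorm W)^-1; have d0 : 0 < d by rewrite invr_gt0 mulr_gt0.
(* The square bounds the derivative; the cubic term bounds the remainder through |W'| <= 2 |W|. *)
pose C := rownorm W ^+ 2 + 2 * rownorm W ^+ 3.
have C0 : 0 < C by rewrite addr_gt0 ?mulr_gt0 ?exprn_gt0.
apply: (@differentiable_matrix_norm _ _ hrow _ (fun H => - (W *m H *m W)) M C d) => //.
- by move=> a X Y; rewrite mulmxDr mulmxDl -scalemxAr -scalemxAl opprD scalerN.
- move=> H; rewrite (matrix_normN hrow) (le_trans (rownormM _ _)) //.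
  rewrite (le_trans (ler_wpM2r (rownorm_ge0 _) (rownormM _ _))) //.
  rewrite mulrAC -expr2 ler_wpM2r ?rownorm_ge0 // lerDl.
  by rewrite mulr_ge0 // exprn_ge0 // rownorm_ge0.
- move=> H Hd.
  have HW : rownorm H * rownorm W <= 2^-1.
    rewrite (le_trans (ler_wpM2r (rownorm_ge0 _) Hd)) // /d invfM -mulrA.
    by rewrite mulVf ?mulr1 ?gt_eqF.
  have u1 : 1%:M + H *m W \in unitmx.
    apply: unitmx_add1; rewrite (le_lt_trans (rownormM _ _)) //.
    by rewrite (le_lt_trans HW) // invf_lt1 // ltr1n.
  have uHM : H + M \in unitmx.
    have -> : H + M = (1%:M + H *m W) *m M by rewrite mulmxDl mul1mx mulmxKV // addrC.
    by rewrite unitmx_mul u1.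
  set W' := invmx (H + M).
  have dW : W' - W = - (W' *m H *m W).
    have e1 : W' *m (H + M) *m W = W by rewrite mulVmx // mul1mx.
    rewrite -[X in _ - X]e1 mulmxDr mulmxDl -[W' *m M *m W]mulmxA mulmxV // mulmx1.
    by rewrite opprD addrCA subrr addr0.
  have W'2 : rownorm W' <= 2 * rownorm W.
    have : rownorm W' <= rownorm W + rownorm W' / 2.
      rewrite -[X in rownorm X <= _](subrK W) dW addrC.
      rewrite (le_trans (rownormD _ _)) // lerD2l (matrix_normN hrow) -mulmxA.
      rewrite (le_trans (rownormM _ _)) // ler_wpM2l ?rownorm_ge0 //.
      exact: le_trans (rownormM _ _) HW.
    by move: (rownorm W') (rownorm W) => x y; lra.
  have -> : W' - W - - (W *m H *m W) = W' *m H *m W *m H *m W.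
    by rewrite opprK dW addrC -mulmxBl -mulmxBl -(opprB W') dW opprK.
  have b5 (A B D E F : 'M[R[i]]_2) : rownorm (A *m B *m D *m E *m F) <=
      rownorm A * rownorm B * rownorm D * rownorm E * rownorm F.
    do 4![rewrite (le_trans (rownormM _ _)) // ler_wpM2r ?rownorm_ge0 //].
  rewrite (le_trans (b5 _ _ _ _ _)) //.
  have -> : C * rownorm H ^+ 2 = rownorm W ^+ 2 * rownorm H ^+ 2 +
     2 * rownorm W * rownorm H * rownorm W * rownorm H * rownorm W.
    by rewrite /C; ring.
  rewrite ler_wpDl ?mulr_ge0 ?exprn_ge0 ?rownorm_ge0 //.
  by do 4!(rewrite ler_wpM2r ?rownorm_ge0 //).
Qed.

End Inverse.

(** * The functional calculus of the Laurent expansion *)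

Section FunctionalCalculus.
Variable R : realType.
Implicit Types (l c m z : R[i]) (S T A W M : 'M[R[i]]_2).

(** The row sum norm is pulled back along the similarity of [adapted_conj]; conjugation preserves
    products and the identity. *)
Lemma adapted_norm W (q : R) : (forall z, eigenvalue W z -> normc z < q) ->
  exists nu : 'M[R[i]]_2 -> R, [/\ is_matrix_norm nu,
    forall A B, nu (A *m B) <= nu A * nu B, nu 1 <= 1 & nu W < q].
Proof.
move=> /adapted_conj [S uS Wq]; have uS' : invmx S \in unitmx by rewrite unitmx_inv.
exists (fun A => rownorm (conj2 (invmx S) A)); split => //.
- split => [A /rownorm0_eq0 A0|A B|a A].
  + have := conj2K uS' A; rewrite A0 invmxK => <-.
    by rewrite /conj2 mulmx0 mul0mx.
  + by rewrite conj2D rownormD.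
  + by rewrite conj2Z rownormZ.
- by move=> A B; rewrite -conj2M // rownormM.
- by rewrite -[1]/(1%:M) conj2_1 // rownorm1.
Qed.

Variables (r : R) (b : R[i]) (b_ : nat -> R[i]) (phi : R[i] -> R[i]).
Hypothesis r0 : 0 < r.
Hypothesis phiE : forall z, exterior r z ->
  series (fun k => b_ k / z ^+ k) @ \oo --> phi z - b * z.

(** At the real point z = s the series converges, so its terms b_k / s^k tend to 0 and are
    bounded. *)
Lemma coef_bound (s : R) : r < s ->
  exists B, forall k, normc (b_ k) <= B * s ^+ k.
Proof.
move=> rs; have s0 : 0 < s by rewrite (lt_trans r0).
have ext : exterior r s%:C%C by change (r < normc s%:C%C); rewrite normc_real gtr0_norm.
have /cvg_series_cvg_0 : cvgn (series (fun k => b_ k / s%:C%C ^+ k)).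
  by apply/cvg_ex; eexists; exact: phiE ext.
move=> /cvg_normcP bs.
have /cvg_seq_bounded : cvgn (fun k => normc (b_ k / s%:C%C ^+ k - 0)).
  by apply/cvg_ex; exists 0.
move=> [B [_ /(_ (B + 1))]]; rewrite ltrDl ltr01 => /(_ isT) bB.
exists (B + 1) => k; have /= := bB k I.
rewrite subr0 ger0_norm ?normc_ge0 // normcM normcV normcX normc_real gtr0_norm //.
by rewrite ler_pdivrMr ?exprn_gt0.
Qed.

Lemma exterior_unitmx M : spectrum_in (exterior r) M -> M \in unitmx.
Proof.
move=> eM; rewrite -row_free_unit -kermx_eq0; apply/negPn/negP => K0.
have : eigenvalue M 0 by rewrite /eigenvalue /eigenspace raddf0 subr0.
move=> /eM h; have : r < normc (0 : R[i]) := h.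
by rewrite normc0 ltNge (ltW r0).
Qed.

Lemma eigenvalue_invmx M z : M \in unitmx -> eigenvalue (invmx M) z ->
  eigenvalue M z^-1.
Proof.
move=> uM /eigenvalueP [v vM v0]; apply/eigenvalueP; exists v => //.
have z0 : z != 0.
  apply/eqP => z0; move: v0; rewrite -(mulmxKV uM v) vM z0 scale0r mul0mx.
  by rewrite eqxx.
by rewrite -[v in LHS](scalerK z0) -vM -scalemxAl mulmxKV.
Qed.

Lemma exterior_norm M : spectrum_in (exterior r) M ->
  exists nu B s, [/\ is_matrix_norm nu,
    forall A B, nu (A *m B) <= nu A * nu B, nu 1 <= 1,
    0 < s /\ s * nu (invmx M) < 1 & forall k, normc (b_ k) <= B * s ^+ k].
Proof.
move=> eM; have uM := exterior_unitmx eM.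
have [|nu [hnu nuM nu1 nuW]] := @adapted_norm (invmx M) r^-1.
  move=> z /(eigenvalue_invmx uM) /eM; rewrite /exterior /= normcV => rz.
  by rewrite -[ltLHS]invrK ltf_pV2 // posrE (lt_trans r0).
(* The midpoint of nu(M^-1) and 1/r. Then s = 1/q exceeds r, so [coef_bound] applies, while s
   nu(M^-1) < 1. *)
pose q := (nu (invmx M) + r^-1) / 2.
have q0 : 0 < q.
  by rewrite divr_gt0 // ltr_wpDl ?(matrix_norm_ge0 hnu) ?invr_gt0.
have qr : q < r^-1 by rewrite /q; move: nuW; lra.
have nuq : nu (invmx M) < q by rewrite /q; move: nuW; lra.
have rq : r < q^-1 by rewrite -[ltLHS]invrK ltf_pV2 // posrE invr_gt0.
have [B bB] := coef_bound rq.
exists nu, B, q^-1; split => //; split; first by rewrite invr_gt0.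
by rewrite mulrC ltr_pdivrMr // mul1r.
Qed.

Definition boettcher_mx M := b *: M + mxseries b_ (invmx M).

Lemma cvg_boettcher_mx M : spectrum_in (exterior r) M ->
  b *: M + series (fun k => b_ k *: invmx M ^+ k) n @[n --> \oo] --> boettcher_mx M.
Proof.
move=> /exterior_norm [nu [B [s [hnu nuM nu1 [s0 sW] bB]]]].
apply: cvgD; first exact: cvg_cst.
exact: (cvg_mxseries hnu nuM nu1 bB (ltW s0)).
Qed.

Lemma differentiable_boettcher_mx M : spectrum_in (exterior r) M ->
  differentiable boettcher_mx M.
Proof.
move=> eM; have [nu [B [s [hnu nuM nu1 [s0 sW] bB]]]] := exterior_norm eM.
apply: differentiableD.
  by apply: differentiableZ; exact: ex_diff.
apply: (@differentiable_comp _ _ _ _ invmx (mxseries b_)).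
  exact/differentiable_invmx/exterior_unitmx.
exact: (differentiable_mxseries hnu nuM nu1 bB).
Qed.

Lemma spectrum_in_conj2 (U : set R[i]) S A : S \in unitmx ->
  spectrum_in U (conj2 S A) <-> spectrum_in U A.
Proof. by move=> uS; split => UA z zA; apply: UA; move: zA; rewrite conj2_eigenvalue. Qed.

Lemma spectrum_in_lower2 (U : set R[i]) l c m :
  spectrum_in U (lower2 l c m) <-> U l /\ U m.
Proof.
split => [Ul|[Ul Um] z]; first by split; apply: Ul; rewrite lower2_eigenvalue eqxx ?orbT.
by rewrite lower2_eigenvalue => /orP[] /eqP ->.
Qed.

(** Conjugation commutes with the partial sums and is continuous, so the two sides are limits of the
    same sequence. *)
Lemma boettcher_mx_conj2 S A : S \in unitmx -> spectrum_in (exterior r) A ->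
  boettcher_mx (conj2 S A) = conj2 S (boettcher_mx A).
Proof.
move=> uS eA; have uA := exterior_unitmx eA.
have c1 := cvg_boettcher_mx (proj2 (spectrum_in_conj2 _ A uS) eA).
have c2 : conj2 S (b *: A + series (fun k => b_ k *: invmx A ^+ k) n)
    @[n --> \oo] --> conj2 S (boettcher_mx A).
  by apply: cvg_mxr; apply: cvg_mxl; exact: cvg_boettcher_mx.
have e n : conj2 S (b *: A + series (fun k => b_ k *: invmx A ^+ k) n) =
    b *: conj2 S A + series (fun k => b_ k *: invmx (conj2 S A) ^+ k) n.
  rewrite conj2D [conj2 S (b *: A)]conj2Z [series _ in LHS]seriesEnat.
  rewrite [series _]seriesEnat conj2_sum; congr (_ + _); apply: eq_bigr => k _.
  by rewrite conj2Z conj2X // conj2_inv.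
rewrite (funext e) in c2.
exact: (cvg_unique (@norm_hausdorff _ 'M[R[i]]_2) c1 c2).
Qed.

(** Read off entry by entry: the diagonal entries of the partial sums are partial sums of the
    expansion of [phi] at l and m. The off-diagonal entry stays implicit; it only has to vanish on
    diagonal matrices. *)
Lemma boettcher_mx_lower2 l c m : exterior r l -> exterior r m ->
  exists2 c', boettcher_mx (lower2 l c m) = lower2 (phi l) c' (phi m)
    & c = 0 -> c' = 0.
Proof.
move=> el em; have eT : spectrum_in (exterior r) (lower2 l c m) by apply/spectrum_in_lower2.
have nz z : exterior r z -> z != 0.
  by rewrite -normc_gt0; apply: lt_trans.
have [l0 m0] := (nz _ el, nz _ em).
have cT := cvg_boettcher_mx eT.
have ent i j : (b *: lower2 l c m + series (fun k => b_ k *: invmx (lower2 l c m) ^+ k) n) i j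
    @[n --> \oo] --> boettcher_mx (lower2 l c m) i j by exact: cvg_entry.
have entE i j n : (b *: lower2 l c m + series (fun k => b_ k *: invmx (lower2 l c m) ^+ k) n) i j =
   b * lower2 l c m i j + series (fun k => b_ k * (invmx (lower2 l c m) ^+ k) i j) n.
  rewrite !seriesEnat mxE [X in X + _]mxE summxE; congr (_ + _).
  by apply: eq_bigr => k _; rewrite mxE.
have lim_ent i j (u : nat -> R[i]) a : (forall n, b * lower2 l c m i j +
     series (fun k => b_ k * (invmx (lower2 l c m) ^+ k) i j) n = u n) ->
   u @ \oo --> a -> boettcher_mx (lower2 l c m) i j = a.
  move=> eu ua; have := ent i j; rewrite (funext (fun n => etrans (entE i j n) (eu n))).
  by move=> ua'; exact: (cvg_unique (@norm_hausdorff _ R[i]) ua' ua).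
have phi_cvg z : exterior r z ->
    b * z + series (fun k => b_ k / z ^+ k) n @[n --> \oo] --> phi z.
  move=> ez; rewrite -[phi z](subrK (b * z)) [X in _ --> X]addrC.
  by apply: cvgD; [exact: cvg_cst|exact: phiE].
have powE k : invmx (lower2 l c m) ^+ k =
    lower2 (l ^- k) (- (c / (l * m)) * power_diffquot l^-1 m^-1 k) (m ^- k).
  by rewrite lower2_invmx // lower2X !exprVn.
exists (boettcher_mx (lower2 l c m) 1 0).
  apply: mx2P; rewrite [in RHS]mxE //=.
  - apply: lim_ent (phi_cvg _ el) => n; rewrite mxE /=; congr (_ + _).
    by rewrite !seriesEnat; apply: eq_bigr => k _; rewrite powE mxE.
  - apply: (lim_ent _ _ (fun=> 0)); last exact: cvg_cst.
    move=> n; rewrite mxE /= mulr0 add0r seriesEnat /= big1 // => k _.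
    by rewrite powE mxE /= mulr0.
  - apply: lim_ent (phi_cvg _ em) => n; rewrite mxE /=; congr (_ + _).
    by rewrite !seriesEnat; apply: eq_bigr => k _; rewrite powE mxE.
move=> c0; apply: (lim_ent _ _ (fun=> 0)); last exact: cvg_cst.
move=> n; rewrite seriesEnat mxE /= [X in _ + X]big1; first by rewrite c0 mulr0 addr0.
by move=> k _; rewrite powE mxE /= c0 mul0r oppr0 mul0r mulr0.
Qed.

End FunctionalCalculus.

(** * The matrix polynomial on triangular matrices, and its continuity *)

Section PolynomialMap.
Variable R : realType.
Implicit Types (l c m z : R[i]) (S T A M : 'M[R[i]]_2) (p : {poly R[i]}).

Lemma horner_mx_sum p A : horner_mx A p = \sum_(k < size p) p`_k *: A ^+ k.
Proof.
rewrite -[in LHS](coefK p) poly_def rmorph_sum /=; apply: eq_bigr => k _.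
by rewrite horner_mxZ rmorphXn /= horner_mx_X.
Qed.

Lemma horner_mx_conj2 p S A : S \in unitmx ->
  horner_mx (conj2 S A) p = conj2 S (horner_mx A p).
Proof.
move=> uS; rewrite !horner_mx_sum /conj2 mulmx_sumr mulmx_suml.
by apply: eq_bigr => k _; rewrite -!/(conj2 _ _) conj2Z conj2X.
Qed.

(** The divided difference (p(l) - p(m)) / (l - m), which is p'(l) when l = m. *)
Definition diffquot p l m := \sum_(k < size p) p`_k * power_diffquot l m k.

Lemma horner_mx_lower2 p l c m :
  horner_mx (lower2 l c m) p = lower2 p.[l] (c * diffquot p l m) p.[m].
Proof.
rewrite horner_mx_sum /diffquot !horner_coef mulr_sumr.
under eq_bigr do rewrite lower2X lower2Z.
apply: mx2P; rewrite summxE [in RHS]mxE /=.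
- by apply: eq_bigr => k _; rewrite mxE.
- by apply: big1 => k _; rewrite mxE.
- by apply: eq_bigr => k _; rewrite mxE /= mulrCA.
- by apply: eq_bigr => k _; rewrite mxE.
Qed.

(** The divided difference of z^k is a sum of k monomials of degree k - 1, and X >= 1 lets X^n
    dominate all the lower powers. *)
Lemma diffquot_bound p n : (size p <= n.+2)%N -> exists2 C, 0 < C &
  forall l m X, 1 <= X -> normc l <= X -> normc m <= X ->
    normc (diffquot p l m) <= C * X ^+ n.
Proof.
move=> sp; pose C := \sum_(k < size p) normc p`_k * k%:R.
have C0 : 0 <= C by apply: sumr_ge0 => k _; rewrite mulr_ge0 ?normc_ge0.
exists (C + 1) => [|l m X X1 lX mX]; first by rewrite ltr_pwDr.
have X0 : 0 <= X by rewrite (le_trans _ X1).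
have hk k : normc (power_diffquot l m k) <= k%:R * X ^+ k.-1.
  elim: k => [|k IH]; first by rewrite mul0r normc_zero.
  rewrite [power_diffquot _ _ _]/= (le_trans (normcD _ _)) //.
  rewrite -natr1 mulrDl mul1r normcM normcX lerD //.
    (* For k = 0 the truncated exponent [k.-1] breaks the power rule, but the term is zero. *)
    case: k IH => [|k] IH; first by rewrite mul0r (le_trans (ler_wpM2r _ IH)) ?normc_ge0 // mul0r mul0r.
    by rewrite [in leRHS]exprSr mulrA ler_pM ?normc_ge0.
  by rewrite lerXn2r ?nnegrE ?normc_ge0.
apply: (@le_trans _ _ (C * X ^+ n)); last by rewrite ler_wpM2r ?exprn_ge0 // lerDl.
rewrite (le_trans (normc_sum _ _)) // mulr_suml; apply: ler_sum => k _.
rewrite normcM -mulrA ler_wpM2l ?normc_ge0 // (le_trans (hk k)) //.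
rewrite ler_wpM2l // ler_weXn2l //.
have := leq_trans (ltn_ord k) sp; by case: (k : nat).
Qed.

(** Writes f g = (f - A)(g - B) + (f B - A B) + A g; the first two summands tend to 0. *)
Lemma cvg_mulmx (F : set_system nat) {FF : Filter F} (f g : nat -> 'M[R[i]]_2) A B :
  f @ F --> A -> g @ F --> B -> f x *m g x @[x --> F] --> A *m B.
Proof.
move=> fA gB.
have fg0 : (f x - A) *m (g x - B) @[x --> F] --> (0 : 'M[R[i]]_2).
  apply/cvg_rownormP.
  have : rownorm (f x - A) * rownorm (g x - B) @[x --> F] --> (0 : R) * 0.
    by apply: cvgM; apply/cvg_rownormP.
  rewrite mulr0 => FG; apply: (squeeze_cvgr _ (cvg_cst 0) FG).
  by near=> x; rewrite rownorm_ge0 /= subr0 rownormM.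
have FB : f x *m B - A *m B @[x --> F] --> (0 : 'M[R[i]]_2).
  by apply/subr_cvg0; apply: cvg_mxr.
have AG : A *m g x @[x --> F] --> A *m B by apply: cvg_mxl.
have e x : f x *m g x = (f x - A) *m (g x - B) + (f x *m B - A *m B) + A *m g x.
  by rewrite mulmxBl !mulmxBr opprB addrACA subrK -addrA [_ - _ - _]addrAC subrr sub0r
    addNr addr0.
suff H L : L = 0 + 0 + A *m B -> f x *m g x @[x --> F] --> L.
  by apply: H; rewrite !add0r.
move=> ->; rewrite (funext e); apply: cvgD AG; exact: cvgD fg0 FB.
Unshelve. all: by end_near. Qed.

Lemma cvg_mxX (F : set_system nat) {FF : Filter F} (f : nat -> 'M[R[i]]_2) A k :
  f @ F --> A -> f x ^+ k @[x --> F] --> A ^+ k.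
Proof.
move=> fA; elim: k => [|k IH].
  by under eq_fun do rewrite expr0; rewrite expr0; exact: cvg_cst.
by under eq_fun do rewrite exprS -mulmxE; rewrite exprS -mulmxE; exact: cvg_mulmx.
Qed.

Lemma cvg_horner_mx (F : set_system nat) {FF : Filter F} (f : nat -> 'M[R[i]]_2) A p :
  f @ F --> A -> horner_mx (f x) p @[x --> F] --> horner_mx A p.
Proof.
move=> fA; under eq_fun do rewrite horner_mx_sum; rewrite horner_mx_sum.
apply: cvg_big => [|k _]; first exact: add_continuous.
by apply: cvgZl_tmp; exact: cvg_mxX.
Qed.

(** * The functional equation *)

Section FunctionalEquation.
Variables (r : R) (b : R[i]) (b_ : nat -> R[i]) (phi : R[i] -> R[i]) (p : {poly R[i]}).
Variable d : nat.
Hypothesis r0 : 0 < r.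
Hypothesis phiE : forall z, exterior r z ->
  series (fun k => b_ k / z ^+ k) @ \oo --> phi z - b * z.
Hypothesis p_ext : forall z, exterior r z -> exterior r p.[z].
Hypothesis phi_p : forall z, exterior r z -> phi p.[z] = phi z ^+ d.

Local Notation Phi := (boettcher_mx b b_).

Lemma spectrum_in_horner_mx M : spectrum_in (exterior r) M ->
  spectrum_in (exterior r) (horner_mx M p).
Proof.
have [S [l [c [m [uS ->]]]]] := triangularisation M.
move=> /(spectrum_in_conj2 _ _ uS) /spectrum_in_lower2 [el em].
rewrite (horner_mx_conj2 _ _ uS) horner_mx_lower2.
apply/(spectrum_in_conj2 _ _ uS)/spectrum_in_lower2.
by split; apply: p_ext.
Qed.

Lemma boettcher_mx_horner_diag S l m : S \in unitmx -> exterior r l -> exterior r m ->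
  Phi (horner_mx (conj2 S (lower2 l 0 m)) p) = Phi (conj2 S (lower2 l 0 m)) ^+ d.
Proof.
move=> uS el em; rewrite (horner_mx_conj2 _ _ uS) horner_mx_lower2 mul0r.
have eT : spectrum_in (exterior r) (lower2 l 0 m) by apply/spectrum_in_lower2.
have eP : spectrum_in (exterior r) (lower2 p.[l] 0 p.[m]).
  by apply/spectrum_in_lower2; split; apply: p_ext.
rewrite [LHS](boettcher_mx_conj2 r0 phiE uS eP).
rewrite [in RHS](boettcher_mx_conj2 r0 phiE uS eT).
have [c1 -> c10] := boettcher_mx_lower2 r0 phiE 0 (p_ext el) (p_ext em).
have [c2 -> c20] := boettcher_mx_lower2 r0 phiE 0 el em.
rewrite (c10 erefl) (c20 erefl) -(conj2X _ _ uS) lower2X mul0r.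
by rewrite (phi_p el) (phi_p em).
Qed.

Lemma lower2_diag l c m : l != m ->
  exists2 S, S \in unitmx & lower2 l c m = conj2 S (lower2 l 0 m).
Proof.
(* Conjugating diag(l, m) by the unipotent matrix with entry t creates the off-diagonal entry t (m -
   l). *)
move=> lm; pose t := c / (m - l).
have ml : m - l != 0 by rewrite subr_eq0 eq_sym.
have u : lower2 1 t 1 *m lower2 1 (- t) 1 = 1%:M.
  by rewrite lower2M -lower2_1; congr lower2; ring.
have [uS _] := mulmx1_unit u; exists (lower2 1 t 1) => //.
rewrite /conj2 lower2_invmx ?oner_neq0 // !lower2M /t; congr lower2; field => //.
Qed.

Lemma boettcher_mx_horner M : spectrum_in (exterior r) M ->
  Phi (horner_mx M p) = Phi M ^+ d.
Proof.
have [S [l [c [m [uS ->]]]]] := triangularisation M.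
have distinct m' : l != m' -> exterior r l -> exterior r m' ->
    Phi (horner_mx (conj2 S (lower2 l c m')) p) = Phi (conj2 S (lower2 l c m')) ^+ d.
  move=> lm' el em'; have [T uT ->] := lower2_diag c lm'; rewrite (conj2_comp _ uS uT).
  by apply: boettcher_mx_horner_diag el em'; rewrite unitmx_mul uT.
move=> eM; have := eM => /(spectrum_in_conj2 _ _ uS) /spectrum_in_lower2 [el em].
have [lm|] := eqVneq l m; last by move=> lm; exact: distinct.
(* A double eigenvalue is split by e n -> 0, and both sides are continuous. *)
pose e (n : nat) : R[i] := (n.+1%:R^-1)%:C%C.
have e0 n : l != m + e n.
  rewrite lm -subr_eq0 opprD addrA subrr sub0r oppr_eq0 -normc_eq0 normc_real.
  by rewrite normr_eq0 invr_eq0 pnatr_eq0.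
have ee : normc (e n) @[n --> \oo] --> (0 : R).
  under eq_fun do rewrite normc_real gtr0_norm ?invr_gt0 ?ltr0n //.
  exact: cvg_harmonic.
pose Mn n := conj2 S (lower2 l c (m + e n)).
have MnM : Mn @ \oo --> conj2 S (lower2 l c m).
  apply: cvg_mxr; apply: cvg_mxl; apply/cvg_rownormP.
  apply: (squeeze_cvgr _ (cvg_cst 0) ee); near=> n; rewrite rownorm_ge0 /=.
  have -> : lower2 l c (m + e n) - lower2 l c m = lower2 0 0 (e n).
    by apply: mx2P; rewrite !mxE /= ?subrr // addrAC subrr add0r.
  rewrite (le_trans (rownorm_lower2 _ _ _)) // ge_max normc_zero add0r lexx andbT.
  exact: sqrtr_ge0.
(* Differentiability gives continuity, used at M and at its image under p, both with spectrum in the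
   exterior domain. *)
have cPhi A : spectrum_in (exterior r) A -> Phi B @[B --> A] --> Phi A.
  by move=> eA; exact: differentiable_continuous (differentiable_boettcher_mx r0 phiE eA).
have c1 : Phi (horner_mx (Mn n) p) @[n --> \oo] --> Phi (horner_mx (conj2 S (lower2 l c m)) p).
  have cp : horner_mx (Mn n) p @[n --> \oo] --> horner_mx (conj2 S (lower2 l c m)) p.
    exact: cvg_horner_mx MnM.
  exact: (cvg_comp _ _ cp (cPhi _ (spectrum_in_horner_mx eM))).
have c2 : Phi (Mn n) ^+ d @[n --> \oo] --> Phi (conj2 S (lower2 l c m)) ^+ d.
  by apply: cvg_mxX; exact: (cvg_comp _ _ MnM (cPhi _ eM)).
apply: (cvg_unique (@norm_hausdorff _ 'M[R[i]]_2) c1).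
apply: (cvg_trans _ c2); apply: near_eq_cvg; near=> n.
(* Once |e n| < |m| - r, the perturbed eigenvalue m + e n is still in the exterior domain. *)
have ne : normc (e n) < normc m - r.
  near: n; move/cvgrPdist_lt: ee => /(_ (normc m - r)); rewrite subr_gt0 => /(_ em).
  by apply: filterS => n; rewrite sub0r normrN ger0_norm ?normc_ge0.
suff en : exterior r (m + e n) by exact: esym (distinct _ (e0 n) el en).
rewrite /exterior /=; have := normcB (m + e n) (e n); rewrite addrK => h.
by move: (normc (m + e n)) (normc (e n)) ne h => x y; lra.
Unshelve. all: by end_near. Qed.

End FunctionalEquation.
End PolynomialMap.

(** * The dynamical Green function *)

Section Green.
Variable R : realType.
Implicit Types (l c m z : R[i]) (S T A M : 'M[R[i]]_2) (p : {poly R[i]}).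

(** Bernoulli's inequality for (1 + 1/2)^n, proved in the stronger form with 2 + n so that the
    induction closes. *)
Lemma bernoulli_half n : n%:R <= 2 * (3 / 2) ^+ n :> R.
Proof.
suff : 2 + n%:R <= 2 * (3 / 2) ^+ n :> R by apply: le_trans; rewrite lerDr.
elim: n => [|n IH]; first by rewrite expr0 mulr1 addr0.
have n0 : 0 <= n%:R :> R by [].
rewrite exprS -[n.+1%:R]natr1; move: IH n0; move: ((3 / 2) ^+ n) => x; lra.
Qed.

Lemma cvg_natV_exp (d : nat) : (2 <= d)%N -> (d%:R ^+ n)^-1 @[n --> \oo] --> (0 : R).
Proof.
move=> d2; have d1 : 1 < d%:R :> R by rewrite ltr1n.
under eq_fun do rewrite -exprVn.
by apply: cvg_expr; rewrite ger0_norm ?invr_ge0 // invf_lt1 // (lt_trans _ d1).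
Qed.

(** Since d >= 2, n / d^n <= n / 2^n <= 2 (3/4)^n. *)
Lemma cvg_nat_div_exp (d : nat) : (2 <= d)%N ->
  (d%:R ^+ n)^-1 * n%:R @[n --> \oo] --> (0 : R).
Proof.
move=> d2; have d0 : 0 < d%:R :> R by rewrite ltr0n (leq_trans _ d2).
have h : 2 * (3 / 4) ^+ n @[n --> \oo] --> (2 * 0 : R).
  by apply: cvgMl_tmp; apply: cvg_expr; rewrite ger0_norm ?divr_ge0 // ltr_pdivrMr // mul1r ltr_nat.
rewrite mulr0 in h; apply: (squeeze_cvgr _ (cvg_cst 0) h).
near=> n; rewrite mulr_ge0 ?invr_ge0 ?exprn_ge0 ?(ltW d0) //=.
have -> : (3 / 4) ^+ n = (2 ^+ n)^-1 * (3 / 2) ^+ n :> R.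
  by rewrite -exprVn -exprMn; congr (_ ^+ _); field.
rewrite mulrCA ler_pM ?invr_ge0 ?exprn_ge0 ?(ltW d0) ?bernoulli_half //.
by rewrite lef_pV2 ?posrE ?exprn_gt0 // lerXn2r ?nnegrE ?(ltW d0) // ler_nat.
Unshelve. all: by end_near. Qed.

Lemma spectral_radius_conj2_lower2 S l c m : S \in unitmx ->
  spectral_radius (conj2 S (lower2 l c m)) = Num.max (normc l) (normc m).
Proof.
move=> uS; rewrite /spectral_radius.
have -> : [set normc z | z in [set z | eigenvalue (conj2 S (lower2 l c m)) z]] =
    [set normc l; normc m].
  apply/seteqP; split => [_ [z /= + <-]|_ [] ->].
  - by rewrite (conj2_eigenvalue _ _ uS) lower2_eigenvalue => /orP[] /eqP ->; [left|right].
  - by exists l => //=; rewrite (conj2_eigenvalue _ _ uS) lower2_eigenvalue eqxx.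
  - by exists m => //=; rewrite (conj2_eigenvalue _ _ uS) lower2_eigenvalue eqxx orbT.
have ub : ubound [set normc l; normc m] (Num.max (normc l) (normc m)).
  by move=> _ [] ->; rewrite le_max lexx ?orbT.
apply/eqP; rewrite eq_le; apply/andP; split.
  by apply: ge_sup => //; exists (normc l); left.
rewrite ge_max; apply/andP; split; apply: ub_le_sup; first by eexists; exact: ub.
- by left.
- by eexists; exact: ub.
- by right.
Qed.

(** Absorbs the triangularising matrix into the norm, so that only iterates of a triangular matrix
    have to be estimated. *)
Lemma is_matrix_norm_conj2 (N : 'M[R[i]]_2 -> R) S : S \in unitmx ->
  is_matrix_norm N -> is_matrix_norm (fun A => N (conj2 S A)).
Proof.
move=> uS hN; split => [A /(matrix_norm0_eq0 hN) A0|A B|a A].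
- have := conj2K uS A; rewrite A0 /conj2 => <-.
  by rewrite mulmx0 mul0mx.
- by rewrite conj2D; exact: matrix_normD.
- by rewrite conj2Z; exact: matrix_normZ.
Qed.

Variables (d : nat) (p : {poly R[i]}) (r : R) (phi : R[i] -> R[i]) (g : R[i] -> R).
Hypothesis d2 : (2 <= d)%N.
Hypothesis sp : size p = d.+1.
Hypothesis r1 : 1 < r.
Hypothesis p_ext : forall z, exterior r z -> exterior r p.[z].
Hypothesis phi_p : forall z, exterior r z -> phi p.[z] = phi z ^+ d.
Hypothesis phi0 : forall z, exterior r z -> phi z != 0.
Hypothesis g_cont : continuous g.
Hypothesis g_log : exists A B : R, forall z, A < normc z -> `|g z - ln (normc z)| <= B.
Hypothesis g_phi : forall z, exterior r z -> g z = ln (normc (phi z)).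

Let r0 : 0 < r. Proof. exact: lt_trans r1. Qed.

(* No lower bound on |phi| is available here: points of the filled Julia set in
   the exterior domain are not excluded, but then both logarithms stay bounded. *)
Lemma ln_phi_dist : exists B, forall z, exterior r z ->
  `|ln (normc z) - ln (normc (phi z))| <= B.
Proof.
have [A [B AB]] := g_log; have [B1 gB1] := continuous_bounded_disk A g_cont.
exists (`|B| + (`|ln A| + `|B1|)) => z ez; rewrite -(g_phi ez).
(* For |z| > A the logarithmic pole gives the bound; for 1 < |z| <= A both ln|z| and, by continuity,
   g are bounded. *)
have [zA|Az] := leP (normc z) A; last first.
  rewrite distrC (le_trans (AB z Az)) // (le_trans (ler_norm B)) // lerDl.
  by rewrite addr_ge0.
rewrite (le_trans (ler_normB _ _)) // ler_wpDl // lerD //; last first.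
  exact: le_trans (gB1 z zA) (ler_norm _).
have z1 : 1 < normc z by exact: lt_trans r1 ez.
have lz0 : 0 <= ln (normc z) by rewrite ln_ge0 // ltW.
rewrite (ger0_norm lz0) (le_trans _ (ler_norm _)) //.
by rewrite ler_ln ?posrE ?(lt_trans _ z1) // (lt_le_trans _ zA) ?(lt_trans _ z1).
Qed.

Lemma exterior_iter z n : exterior r z -> exterior r (iter n (horner p) z).
Proof. by move=> ez; elim: n => //= n; exact: p_ext. Qed.

Lemma phi_iter z n : exterior r z ->
  phi (iter n (horner p) z) = phi z ^+ (d ^ n).
Proof.
move=> ez; elim: n => [|n IH]; first by rewrite expn0 expr1.
by rewrite iterS (phi_p (exterior_iter n ez)) IH -exprM expnSr.
Qed.

(** [ln_phi_dist] at the n-th iterate, exponentiated; there [phi] equals phi(z)^(d^n), and B does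
    not depend on n or z. The second inequality carries an extra factor B on both sides. *)
Lemma orbit_bounds : exists2 B, 0 < B & forall z n, exterior r z ->
  normc (iter n (horner p) z) <= B * normc (phi z) ^+ (d ^ n) <=
    B ^+ 2 * normc (iter n (horner p) z).
Proof.
have [B hB] := ln_phi_dist; exists (expR B) => [|z n ez]; first exact: expR_gt0.
have en := exterior_iter n ez; have := hB _ en; rewrite (phi_iter n ez) normcX.
have w0 : 0 < normc (iter n (horner p) z) by exact: lt_trans en.
have f0 : 0 < normc (phi z) ^+ (d ^ n) by rewrite exprn_gt0 // normc_gt0 phi0.
move: (normc (iter _ _ _)) (normc (phi z) ^+ _) w0 f0 => w f w0 f0.
rewrite ler_norml => /andP[lo up].
rewrite -[w]lnK // -[f]lnK // -expRM_natl -!expRD !ler_expR.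
by apply/andP; split; move: lo up; move: (ln w) (ln f) => x y; lra.
Qed.

(** * Growth of the iterates of a triangular matrix *)

Section Orbit.
Variables (l c m : R[i]).
Hypotheses (el : exterior r l) (em : exterior r m).

Fixpoint offdiag n : R[i] := if n is n'.+1 then
  offdiag n' * diffquot p (iter n' (horner p) l) (iter n' (horner p) m) else c.

Lemma iter_horner_mx_lower2 S n : S \in unitmx ->
  iter n (mxpoly_map p) (conj2 S (lower2 l c m)) =
  conj2 S (lower2 (iter n (horner p) l) (offdiag n) (iter n (horner p) m)).
Proof.
move=> uS; elim: n => [|n IH]; first by [].
by rewrite iterS IH /mxpoly_map (horner_mx_conj2 _ _ uS) horner_mx_lower2.
Qed.

Let rho := Num.max (normc (phi l)) (normc (phi m)).

Let rho0 : 0 < rho.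
Proof. by rewrite lt_max normc_gt0 phi0. Qed.

(** Both eigenvalue orbits grow at most like rho^(d^n). Conversely, the orbit of the eigenvalue
    attaining [rho] is a diagonal entry, which the row sum norm dominates. *)
Lemma orbit_max_bounds : exists2 B, 0 < B & forall n,
  Num.max (normc (iter n (horner p) l)) (normc (iter n (horner p) m)) <= B * rho ^+ (d ^ n)
  /\ rho ^+ (d ^ n) <= B * rownorm (lower2 (iter n (horner p) l) (offdiag n) (iter n (horner p) m)).
Proof.
have [B B0 hB] := orbit_bounds; exists B => // n.
have /andP[l1 l2] := hB l n el; have /andP[m1 m2] := hB m n em.
have lr : normc (phi l) ^+ (d ^ n) <= rho ^+ (d ^ n).
  by rewrite lerXn2r ?nnegrE ?normc_ge0 ?(ltW rho0) // le_max lexx.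
have mr : normc (phi m) ^+ (d ^ n) <= rho ^+ (d ^ n).
  by rewrite lerXn2r ?nnegrE ?normc_ge0 ?(ltW rho0) // le_max lexx orbT.
split.
  rewrite ge_max; apply/andP; split.
    by rewrite (le_trans l1) // ler_wpM2l ?(ltW B0).
  by rewrite (le_trans m1) // ler_wpM2l ?(ltW B0).
set T := lower2 _ _ _.
have T00 : normc (iter n (horner p) l) <= rownorm T.
  by rewrite -[iter n _ l](_ : T 0 0 = _) ?normc_le_rownorm // mxE.
have T11 : normc (iter n (horner p) m) <= rownorm T.
  by rewrite -[iter n _ m](_ : T 1 1 = _) ?normc_le_rownorm // mxE.
(* Multiplying by B gives the form of [orbit_bounds]; the case split selects the eigenvalue that
   attains the maximum. *)
rewrite -(ler_pM2l B0) mulrA -expr2.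
rewrite /rho; case: (leP (normc (phi l)) (normc (phi m))) => _.
  by rewrite (le_trans m2) // ler_wpM2l ?exprn_ge0 ?(ltW B0).
by rewrite (le_trans l2) // ler_wpM2l ?exprn_ge0 ?(ltW B0).
Qed.

(* The factors telescope since (d - 1)(1 + d + ... + d^(n-1)) = d^n - 1; the
   factor rho on the left compensates for the - 1. *)
Lemma offdiag_bound : exists2 D, 1 <= D & forall n,
  normc (offdiag n) * rho <= normc c * D ^+ n * rho ^+ (d ^ n).
Proof.
have [B B0 hB] := orbit_max_bounds.
have [C C0 hC] : exists2 C, 0 < C & forall l m X, 1 <= X -> normc l <= X -> normc m <= X ->
    normc (diffquot p l m) <= C * X ^+ d.-1.
  by apply: diffquot_bound; rewrite sp prednK // (leq_trans _ d2).
(* The product bounds one difference quotient relative to the matching power of [rho]; the 1 ensures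
   D >= 1. *)
pose D := C * B ^+ d.-1 + 1.
have CB : 0 <= C * B ^+ d.-1 by rewrite mulr_ge0 ?exprn_ge0 ?(ltW C0) ?(ltW B0).
have D1 : 1 <= D by rewrite lerDr.
exists D => // n; elim: n => [|n IH]; first by rewrite /= expn0 expr1 expr0 mulr1.
have [up _] := hB n; rewrite [offdiag _]/= normcM mulrAC.
set X := Num.max _ _ in up.
have X1 : 1 <= X.
  by rewrite le_max (ltW (lt_trans r1 (exterior_iter n el))).
have := hC (iter n (horner p) l) (iter n (horner p) m) X X1.
rewrite !le_max !lexx orbT => /(_ isT isT) dq.
have dq' : normc (diffquot p (iter n (horner p) l) (iter n (horner p) m)) <=
    D * rho ^+ (d ^ n * d.-1).
  rewrite (le_trans dq) //; apply: (@le_trans _ _ (C * B ^+ d.-1 * rho ^+ (d ^ n * d.-1))).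
    rewrite -mulrA ler_wpM2l ?(ltW C0) // exprM -exprMn lerXn2r ?nnegrE //.
      by rewrite (le_trans _ X1).
    by rewrite mulr_ge0 ?exprn_ge0 ?(ltW B0) ?(ltW rho0).
  by rewrite ler_wpM2r ?exprn_ge0 ?(ltW rho0) // lerDl.
have -> : normc c * D ^+ n.+1 * rho ^+ (d ^ n.+1) =
    (normc c * D ^+ n * rho ^+ (d ^ n)) * (D * rho ^+ (d ^ n * d.-1)).
  have -> : (d ^ n.+1 = d ^ n + d ^ n * d.-1)%N.
    by rewrite -mulnS prednK ?expnSr // (leq_trans _ d2).
  by rewrite exprD exprSr; ring.
by rewrite ler_pM ?mulr_ge0 ?normc_ge0 ?(ltW rho0).
Qed.

Lemma rownorm_orbit : exists k E D, [/\ 0 < k, 0 < E, 1 <= D & forall n,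
  k * rho ^+ (d ^ n) <=
    rownorm (lower2 (iter n (horner p) l) (offdiag n) (iter n (horner p) m)) <=
    E * D ^+ n * rho ^+ (d ^ n)].
Proof.
have [B B0 hB] := orbit_max_bounds; have [D D1 hD] := offdiag_bound.
(* The constant B accounts for a diagonal entry and |c| / rho for the off-diagonal one, dividing out
   the extra [rho] of [offdiag_bound]. As D^n >= 1, the diagonal bound also fits under the common
   factor D^n. *)
exists B^-1, (B + normc c / rho), D; split => //.
- by rewrite invr_gt0.
- by rewrite ltr_pwDl // divr_ge0 ?normc_ge0 ?(ltW rho0).
move=> n; have [up lo] := hB n; rewrite ler_pdivrMl // lo /=.
rewrite (le_trans (rownorm_lower2 _ _ _)) //.
have Dn : 1 <= D ^+ n by rewrite exprn_ege1.
have rn : 0 <= rho ^+ (d ^ n) by rewrite exprn_ge0 ?(ltW rho0).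
have cn : normc (offdiag n) <= normc c / rho * D ^+ n * rho ^+ (d ^ n).
  rewrite (_ : _ * _ = normc c * D ^+ n * rho ^+ (d ^ n) / rho).
    by rewrite ler_pdivlMr.
  by move: (rho ^+ (d ^ n)) (D ^+ n) => x y; ring.
have BD : B * rho ^+ (d ^ n) <= B * D ^+ n * rho ^+ (d ^ n).
  by rewrite ler_wpM2r // ler_peMr ?(ltW B0).
move: up; rewrite ge_max => /andP[lB mB].
have c0 := normc_ge0 (offdiag n).
rewrite ge_max -mulrA mulrDl !mulrA; move: lB mB cn BD c0.
move: (normc _) (normc (iter n _ m)) (normc (offdiag n)) => x y w.
move: (B * _) (B * _ * _) (normc c / rho * _ * _) => a e f lB mB cn BD c0.
by apply/andP; split; lra.
Qed.

(** The norm of the n-th iterate lies between constant multiples of rho^(d^n) and D^n rho^(d^n).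
    After d^-n ln, the constants contribute O(d^-n), the power of D contributes n d^-n ln D, and ln
    rho remains. *)
Lemma green_limit (N : 'M[R[i]]_2 -> R) S : S \in unitmx -> is_matrix_norm N ->
  green_seq N d p (conj2 S (lower2 l c m)) @ \oo --> ln rho.
Proof.
move=> uS hN; have hNS := is_matrix_norm_conj2 uS hN.
have [k1 k10 lo] := rownorm_le_matrix_norm hNS.
have [k2 k20 up] := matrix_norm_le_rownorm hNS.
have [k [E [D [k0 E0 D1 hT]]]] := rownorm_orbit.
have d0 n : 0 < d%:R ^+ n :> R by rewrite exprn_gt0 // ltr0n (leq_trans _ d2).
have D0 : 0 < D by rewrite (lt_le_trans _ D1).
have cV := cvg_natV_exp d2.
have Llo : (d%:R ^+ n)^-1 * ln (k1 * k) + ln rho @[n --> \oo] --> ln rho.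
  rewrite -[X in _ --> X]add0r; apply: cvgD; last exact: cvg_cst.
  by rewrite -[X in _ --> X](mul0r (ln (k1 * k))); apply: cvgMr_tmp.
have Lup : (d%:R ^+ n)^-1 * ln (k2 * E) + (d%:R ^+ n)^-1 * n%:R * ln D + ln rho
    @[n --> \oo] --> ln rho.
  rewrite -[X in _ --> X]add0r; apply: cvgD; last exact: cvg_cst.
  rewrite -[X in _ --> X]addr0; apply: cvgD.
    by rewrite -[X in _ --> X](mul0r (ln (k2 * E))); apply: cvgMr_tmp.
  rewrite -[X in _ --> X](mul0r (ln D)); apply: cvgMr_tmp; exact: cvg_nat_div_exp.
apply: (squeeze_cvgr _ Llo Lup); near=> n.
rewrite /green_seq (iter_horner_mx_lower2 n uS).
set T := lower2 _ _ _; have /andP[Tlo Tup] := hT n.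
have rn : 0 < rho ^+ (d ^ n) by rewrite exprn_gt0.
have Dn : 0 < D ^+ n by rewrite exprn_gt0.
have nlo : k1 * k * rho ^+ (d ^ n) <= N (conj2 S T).
  by rewrite (le_trans _ (lo T)) // -mulrA ler_pM2l.
have nup : N (conj2 S T) <= k2 * E * D ^+ n * rho ^+ (d ^ n).
  by rewrite (le_trans (up T)) // -!mulrA ler_pM2l // !mulrA.
have n0 : 0 < N (conj2 S T) by rewrite (lt_le_trans _ nlo) // !mulr_gt0.
have lnr : ln (rho ^+ (d ^ n)) = d%:R ^+ n * ln rho.
  by rewrite lnXn // -[LHS]mulr_natl natrX.
have eqlo : (d%:R ^+ n)^-1 * ln (k1 * k * rho ^+ (d ^ n)) =
    (d%:R ^+ n)^-1 * ln (k1 * k) + ln rho.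
  by rewrite lnM ?posrE ?mulr_gt0 // lnr mulrDr mulKf ?gt_eqF.
have equp : (d%:R ^+ n)^-1 * ln (k2 * E * D ^+ n * rho ^+ (d ^ n)) =
    (d%:R ^+ n)^-1 * ln (k2 * E) + (d%:R ^+ n)^-1 * n%:R * ln D + ln rho.
  rewrite lnM ?posrE ?mulr_gt0 // [ln (_ * D ^+ n)]lnM ?posrE ?mulr_gt0 // lnr.
  by rewrite (lnXn _ D0) -[ln D *+ n]mulr_natl !mulrDr mulKf ?gt_eqF // mulrA.
rewrite -eqlo -equp; apply/andP; split.
  by rewrite ler_pM2l ?invr_gt0 // ler_ln ?posrE ?mulr_gt0.
by rewrite ler_pM2l ?invr_gt0 // ler_ln ?posrE ?mulr_gt0.
Unshelve. all: by end_near. Qed.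

End Orbit.
End Green.

(** The eigenvalues of [Phi M] are values of [phi], so the range is described through the image of
    [phi], and [Phi] maps the domain to itself as soon as [phi] does. Convergence of [green_seq] is
    asserted separately, so that [dynamical_green] is a genuine limit. *)
Theorem theorem1p3 (R : realType) (d : nat) (p : {poly R[i]}) (r : R)
    (phi : R[i] -> R[i]) (N : 'M[R[i]]_2 -> R)
    (hd : (2 <= d)%N) (hp : size p = d.+1) (hr : 1 < r)
    (hphi : is_bottcher d p r phi) (hN : is_matrix_norm N) :
  exists Phi : 'M[R[i]]_2 -> 'M[R[i]]_2,
    [/\ holomorphic_on (spectrum_in (exterior r)) Phi,
        forall M, spectrum_in (exterior r) M ->
          spectrum_in (phi @` exterior r) (Phi M),
        phi @` exterior r `<=` exterior r ->
          forall M, spectrum_in (exterior r) M ->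
            spectrum_in (exterior r) (Phi M)
      & forall M, spectrum_in (exterior r) M ->
          [/\ Phi (mxpoly_map p M) = Phi M ^+ d,
              cvgn (green_seq N d p M)
            & dynamical_green N d p M = ln (spectral_radius (Phi M))]].
Proof.
case: hphi => _ [b [b_ [_ phiE]]] p_ext phi_p [g [g_cont _ _ g_log] g_phi].
have r0 : 0 < r by exact: lt_trans hr.
pose Phi := boettcher_mx b b_.
(* A single similarity makes M and [Phi M] triangular, with eigenvalues l, m and phi(l), phi(m);
   this yields both the range of [Phi] and the spectral radius. *)
have triPhi M : spectrum_in (exterior r) M -> exists S l c m c',
    [/\ S \in unitmx, exterior r l /\ exterior r m, M = conj2 S (lower2 l c m)
      & Phi M = conj2 S (lower2 (phi l) c' (phi m))].
  have [S [l [c [m [uS ->]]]]] := triangularisation M => eM.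
  have eT := proj1 (spectrum_in_conj2 _ _ uS) eM.
  have [el em] := proj1 (spectrum_in_lower2 _ _ _ _) eT.
  have [c' ec' _] := boettcher_mx_lower2 r0 phiE c el em.
  exists S, l, c, m, c'; split => //.
  by rewrite /Phi (boettcher_mx_conj2 r0 phiE uS eT) ec'.
have spPhi M : spectrum_in (exterior r) M -> spectrum_in (phi @` exterior r) (Phi M).
  move=> /triPhi [S [l [c [m [c' [uS [el em] _ ->]]]]]].
  apply/(spectrum_in_conj2 _ _ uS)/spectrum_in_lower2.
  by split; [exists l|exists m].
exists Phi; split.
- move=> M eM; exact (differentiable_boettcher_mx r0 phiE eM).
- exact: spPhi.
- by move=> sub M eM z zM; apply: sub; exact: spPhi eM z zM.
move=> M eM; have [S [l [c [m [c' [uS [el em] eqM eqPhi]]]]]] := triPhi M eM.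
have phi0 z : exterior r z -> phi z != 0 by move=> /g_phi [].
have gE z : exterior r z -> g z = ln (normc (phi z)) by move=> /g_phi [].
have lim := green_limit hd hp hr p_ext phi_p phi0 g_cont g_log gE c el em uS hN.
rewrite -eqM in lim; split.
- exact (boettcher_mx_horner r0 phiE p_ext phi_p eM).
- by apply/cvg_ex; eexists; exact: lim.
- rewrite /dynamical_green eqPhi (spectral_radius_conj2_lower2 _ _ _ uS).
  exact: cvg_lim lim.
Qed.
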